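(* Let $\kappa,\theta,\sigma>0$ with $\kappa\theta>\sigma^2$, let $T>0$, $Y_0>0$, and set $\alpha=(4\kappa\theta-\sigma^2)/8$, $\beta=\kappa/2$, $\gamma=\sigma/2$. Let $(Y(t))_{t\in[0,T]}$ be the solution of $$dY(t)=\left(\alpha Y(t)^{-1}-\beta Y(t)\right)dt+\gamma\, dW(t),\qquad Y(0)=Y_0.$$ Then there exists a constant $C_3<\infty$, depending only on $\kappa,\theta,\sigma,Y_0,T$ (in particular not on $\Delta t_{\max}$ or the mesh), such that the following holds. Let $0=t_0<t_1<\dots<t_N=T$ be any (potentially random) mesh of $(\mathcal{F}_t)$-stopping times, with $\Delta t_{n+1}=t_{n+1}-t_n$, such that each $\Delta t_{n+1}$ is $\mathcal{F}_{t_n}$-measurable, there is a deterministic integer $N_{\max}<\infty$ with $N\le N_{\max}$ a.s., and there is a deterministic constant $\Delta t_{\max}$ with $$\max_n \Delta t_n\le \Delta t_{\max}\le\min\left\{1,\frac1\kappa\right\}.$$ Let $\{Y_n\}$ be defined by $$Y_{n+1}=e^{-\beta\Delta t_{n+1}}\left(\sqrt{Y_n^2+2\alpha\Delta t_{n+1}}+\gamma\,(W(t_{n+1})-W(t_n))\right)$$ started from $Y_0$, let $\bar Y$ be its continuous version (defined in the context), and let $E_Y(t):=Y(t)-\bar Y(t)$, $t\in[0,T]$. Then $$\max_{t\in[0,T]}\mathbb{E}\left[E_Y(t)^2\right]\le C_3\,\Delta t_{\max}^{1/2},$$ and for each $n=0,\dots,N_{\max}$, $$\mathbb{E}\left[E_Y(t_n)^2\,\mathcal{I}_{\{N\ge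 n\}}\right]\le C_3\,\Delta t_{\max}^{1/2}.$$
   Context: $W$ is a standard one-dimensional Wiener process with natural filtration $(\mathcal{F}_t)_{t\ge0}$; for a stopping time $\tau$, $\mathcal{F}_\tau=\{B\in\mathcal{F}: B\cap\{\tau\le t\}\in\mathcal{F}_t \text{ for all } t\ge 0\}$. The mesh points are distinct; they may be deterministic or chosen path-dependently (adaptively), in which case $N$ is a random positive integer. $\mathcal{I}_A$ denotes the indicator random variable of the event $A$. The SDE and the scheme are driven by the same $W$ and start from the same value $Y_0$. The SDE for $Y$ is the Lamperti transform ($Y=\sqrt X$) of the Cox-Ingersoll-Ross equation $dX(t)=\kappa(\theta-X(t))dt+\sigma\sqrt{X(t)}\,dW(t)$; the condition $\kappa\theta>\sigma^2$ implies the Feller condition $2\kappa\theta>\sigma^2$, so $Y$ is a.s. positive. The continuous version $\bar Y$ of the scheme is defined on each $[t_n,t_{n+1}]$ by $$\bar{Y}(t) = e^{-\beta(t-t_n)}\left(Y_n + \int_{t_n}^t \frac{\alpha}{\sqrt{Y_n^2+2\alpha(s-t_n)}}\, ds\right) + e^{-\beta(t-t_n)} \gamma\, (W(t)-W(t_n)),$$ so that $\bar Y(t_n)=Y_n$ and $\bar Y(t_{n+1})=Y_{n+1}$. *)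

(* Defs.v *)
From HB Require Import structures.
From mathcomp Require Import all_boot all_order all_algebra.
From mathcomp Require Import all_classical all_reals all_analysis.

Set Implicit Arguments.
Unset Strict Implicit.
Unset Printing Implicit Defensive.

Import Order.TTheory GRing.Theory Num.Theory.
Import numFieldNormedType.Exports.

Local Open Scope classical_set_scope.
Local Open Scope ring_scope.

(* Processes have type R -> Omega -> R (time first); only times t >= 0, resp.
   t in [0, T], are constrained by the predicates below. *)

Section wiener.
Context (R : realType) (d : measure_display) (Omega : measurableType d).
Implicit Types (W : R -> Omega -> R) (F : R -> set (set Omega)).

Definition measurable_wrt (G : set (set Omega)) (X : Omega -> R) : Prop :=
  forall B : set R, measurable B -> G (X @^-1` B).

(* The raw natural filtration sigma(W s, 0 <= s <= t). *)
Definition natural_filtration W (t : R) : set (set Omega) :=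
  <<s [set A | exists s : R, exists B : set R,
         [/\ 0 <= s <= t, measurable B & A = W s @^-1` B]] >>.

(* [normal_prob m s] has standard deviation s (and a junk value at s = 0,
   which is why s < t is strict). *)
Definition wiener_process (P : probability Omega R) W : Prop :=
  [/\ forall t, 0 <= t -> measurable_fun setT (W t),
      {ae P, forall w, W 0 w = 0},
      forall w, {within `[0, +oo[, continuous (fun t => W t w)},
      forall s t : R, 0 <= s -> s < t -> forall B : set R, measurable B ->
        P ((fun w => (W t w - W s w)%R) @^-1` B) =
        normal_prob 0 (Num.sqrt (t - s)) B
    & forall s t : R, 0 <= s -> s < t ->
        forall A, natural_filtration W s A -> forall B : set R, measurable B ->
        P (A `&` (fun w => (W t w - W s w)%R) @^-1` B) =
        (P A * P ((fun w => (W t w - W s w)%R) @^-1` B))%E].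

Definition stopping_time F (tau : Omega -> R) : Prop :=
  (forall w, 0 <= tau w) /\
  (forall u, 0 <= u -> F u [set w | tau w <= u]).

Definition stopped_sigma F (tau : Omega -> R) : set (set Omega) :=
  [set B | measurable B /\
           forall u, 0 <= u -> F u (B `&` [set w | tau w <= u])].

End wiener.

Section sde.
Context (R : realType) (d : measure_display) (Omega : measurableType d).

(* Strong solution on [0, T] of dY = (alpha / Y - beta Y) dt + gamma dW,
   Y 0 = Y0. The noise is additive, so the stochastic integral of the constant
   gamma is gamma (W t - W 0). Adaptedness is to the P-augmentation of the
   natural filtration: Y t is a.s. equal to a variable measurable for it.
   The library's convention 0^-1 = 0 does not matter: when 2 alpha > 3 gamma^2
   (that is, kappa theta > sigma^2) a solution a.s. never reaches 0. *)
Definition sde_solution (P : probability Omega R) (W : R -> Omega -> R)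
    (alpha beta gamma Y0 T : R) (Y : R -> Omega -> R) : Prop :=
  let drift w (s : R) := alpha * (Y s w)^-1 - beta * Y s w in
  [/\ forall t, 0 <= t <= T -> measurable_fun setT (Y t),
      forall t, 0 <= t <= T -> exists Z : Omega -> R,
        measurable_wrt (natural_filtration W t) Z /\
        {ae P, forall w, Y t w = Z w},
      forall w, {within `[0, T], continuous (fun t => Y t w)},
      {ae P, forall w,
        lebesgue_measure.-integrable `[0, T] (EFin \o drift w)}
    & {ae P, forall w, forall t, 0 <= t <= T ->
        Y t w = Y0 + \int[lebesgue_measure]_(s in `[0, t]) drift w s
                   + gamma * (W t w - W 0 w)}].

End sde.

Section scheme.
Context (R : realType) (d : measure_display) (Omega : measurableType d).
Implicit Types (W : R -> Omega -> R) (t : nat -> Omega -> R) (N : Omega -> nat).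

(* A random mesh 0 = t_0 < ... < t_N = T. The values t_n w with n > N w carry
   no meaning: they are only asked to keep each t_n a stopping time and each
   t_(n+1) - t_n measurable at t_n, which the values t_n w := T always do.
   A deterministic mesh is the case where t and N are constant in w. *)
Definition random_mesh (F : R -> set (set Omega)) (T : R) t N : Prop :=
  [/\ measurable_fun setT N,
      forall n, stopping_time F (t n),
      forall n, measurable_wrt (stopped_sigma F (t n))
                  (fun w => t n.+1 w - t n w)
    & forall w, [/\ t 0%N w = 0,
        (forall n, (n < N w)%N -> t n w < t n.+1 w)
      & t (N w) w = T]].

Fixpoint scheme (alpha beta gamma Y0 : R) W t (n : nat) (w : Omega) : R :=
  match n with
  | 0 => Y0
  | m.+1 =>
      let dt := t m.+1 w - t m w in
      expR (- beta * dt) *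
      (Num.sqrt (scheme alpha beta gamma Y0 W t m w ^+ 2 + 2 * alpha * dt)
       + gamma * (W (t m.+1 w) w - W (t m w) w))
  end.

(* The last n <= N w with t_n <= s. *)
Definition mesh_index t N (s : R) (w : Omega) : nat :=
  (\max_(n < (N w).+1 | (t n w <= s)%R) n)%N.

(* The interpolation formula is used on the half-open intervals
   [t_n, t_(n+1)[, and at s = T it reduces to Y_N, so the value at each mesh
   point t_n is Y_n. (At the right end t_(n+1) the formula started from Y_n
   gives Y_(n+1) if Y_n >= 0, but not if Y_n < 0, because the integral equals
   sqrt (Y_n^2 + 2 alpha dt) - |Y_n|.) *)
Definition continuous_version (alpha beta gamma Y0 : R) W t N
    (s : R) (w : Omega) : R :=
  let n := mesh_index t N s w in
  let tn := t n w in
  let Yn := scheme alpha beta gamma Y0 W t n w in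
  expR (- beta * (s - tn)) *
    (Yn + \int[lebesgue_measure]_(u in `[tn, s])
            (alpha / Num.sqrt (Yn ^+ 2 + 2 * alpha * (u - tn))))
  + expR (- beta * (s - tn)) * gamma * (W s w - W tn w).

End scheme.

(* Main.v *)
(* The noise is additive, so the error can be controlled path by path. On a mesh
   step let [c u] be the noiseless scheme
   [exp (- beta (u - t_n)) sqrt (Y_n ^ 2 + 2 alpha (u - t_n))] and let
   [p = c - Y + gamma (W - W t_n)], which is differentiable although [W] is not.
   As soon as [|p|] exceeds the oscillation [K] of [gamma W] over one step (plus a
   term of order [dt]), [c] and [Y] are ordered and the dissipative drift
   [alpha / y - beta y] pushes [p] back towards [0]. Hence one-step errors do not
   accumulate and the error at any time is [O(K + dt)]. The paths of [W] are
   Hoelder with exponent [1/4] and a square-integrable constant (Kolmogorov, sixth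
   moments), so [E K ^ 2 = O(dt ^ (1/2))].

   This needs [Y > 0], the only place where [kappa theta > sigma ^ 2] is used. If
   [Y] first vanished at [tau], then [Y t <= C (tau - t) ^ a] before [tau] for some
   [a > 1/4], since the drift is positive near [0]; by the same comparison the
   scheme [S] on a fine uniform mesh is just as small there, and the Riemann sums
   of [S ^ -4] diverge as the mesh is refined. But [1 / (S ^ 2 + eps)] is nearly a
   supermartingale, with compensator at least
   [(2 alpha - 3 gamma ^ 2) / (S ^ 2 + eps) ^ 2], so these sums have bounded
   expectations. *)

Require Import Defs.
From HB Require Import structures.
From mathcomp Require Import all_boot all_order all_algebra.
From mathcomp Require Import all_classical all_reals all_analysis.
From mathcomp Require Import measurable_realfun ring lra.
Import Order.TTheory GRing.Theory Num.Theory.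
Import numFieldNormedType.Exports.
Local Open Scope classical_set_scope.
Local Open Scope ring_scope.

Set Implicit Arguments.
Unset Strict Implicit.
Unset Printing Implicit Defensive.

(** The function behind the positivity argument is [y ^ -2]. By Ito's formula its drift along the
    equation is [2 beta y ^ -2 - (2 alpha - 3 gamma ^ 2) y ^ -4], which is where the threshold comes
    from. The computation is carried out on the scheme rather than on the solution, since there it
    needs only Gaussian integrals and the independence of increments, and no stochastic calculus.
    There is an apparent circle: the comparison with the scheme needs a positive path, and
    positivity is deduced from the comparison. It is broken by stating the comparison on intervals
    where the path is positive, so that it can be used up to any time before the first zero. Three
    scales are tied together at level [j]: a time window [T / 2 ^ j] before the zero, the
    regularization [eps = (4 / 5) ^ (2 j)], and a mesh step of order [T / 4 ^ j]. The step is small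
    against [eps ^ 2], which keeps the error of the discrete computation under control uniformly in
    [j]. *)

Ltac nonneg := repeat match goal with
  | |- _ => assumption
  | |- is_true (0 <= _ * _) => apply: mulr_ge0
  | |- is_true (0 <= _ + _) => apply: addr_ge0
  | |- is_true (0 <= _^-1) => rewrite invr_ge0
  | |- is_true (0 <= _ ^+ 2) => exact: sqr_ge0
  | |- is_true (0 <= _ ^+ _) => first [exact: exprn_even_ge0 | apply: exprn_ge0]
  | |- is_true (0 <= _%:R) => exact: ler0n
  | |- is_true (0 <= expR _) => exact: expR_ge0
  | |- _ => first [done | by apply: ltW]
  end.

(** * Pathwise comparison of the scheme with the solution *)

Section real_functions.
Context {R : realType}.
Implicit Types (p f : R -> R) (a b x : R).

Lemma within_itvcc_eps p a b x : {within `[a, b], continuous p} ->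
  a <= x <= b -> forall e, 0 < e -> exists2 d, 0 < d &
    forall y, a <= y <= b -> `|x - y| < d -> `|p x - p y| < e.
Proof.
move=> /subspace_continuousP cp xab e e0.
have /cp : `[a, b]%classic x by rewrite /= in_itv.
move=> /cvgrPdist_lt /(_ _ e0).
rewrite near_withinE => /nbhs_ballP[d /= d0 H]; exists d => // y yab xy.
by apply: H => //=; rewrite in_itv.
Qed.

Lemma within_itvcy_itvcc f b : {within `[0, +oo[, continuous f} ->
  {within `[0, b], continuous f}.
Proof.
apply: continuous_subspaceW => x /=; rewrite !in_itv/= => /andP[-> _] //.
Qed.

(** The supremum of the set where [p <= M] serves as [r]; continuity puts it back into that set. *)
Lemma last_le_itvcc p a b M : a <= b -> {within `[a, b], continuous p} ->
  p a <= M -> M < p b ->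
  exists r, [/\ a <= r < b, p r <= M & forall u, r < u <= b -> M < p u].
Proof.
move=> ab cp pa pb; pose S := [set u | a <= u <= b /\ p u <= M].
have Sa : S a by split; rewrite ?lexx.
have Sub : ubound S b by move=> u [/andP[_ ->]].
have hS : has_sup S by split; [exists a|exists b].
have ar : a <= sup S by apply: ub_le_sup => //; exists b.
have rb : sup S <= b by apply: ge_sup => //; exists a.
have pr : p (sup S) <= M.
  rewrite leNgt; apply/negP => Mp.
  have Mp0 : 0 < p (sup S) - M by rewrite subr_gt0.
  have sab : a <= sup S <= b by rewrite ar rb.
  have [d d0 H] := within_itvcc_eps cp sab Mp0.
  have [u [uab pu] du] := sup_adherent d0 hS.
  have us : u <= sup S by apply: ub_le_sup => //; exists b.
  have /(H _ uab) : `|sup S - u| < d by rewrite ger0_norm; lra.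
  by rewrite ltNge => /negP; apply; rewrite ler_normr; apply/orP; left; lra.
have rb' : sup S < b.
  by rewrite lt_neqAle rb andbT; apply/eqP => E; move: pr; rewrite E leNgt pb.
exists (sup S); split => //; first by rewrite ar rb'.
move=> u /andP[ru ub]; rewrite ltNge; apply/negP => pu.
have : u <= sup S.
  apply: ub_le_sup; first by exists b.
  by split => //; rewrite ub andbT (le_trans ar)// ltW.
by rewrite leNgt ru.
Qed.

(** The derivative is controlled only above the level. After the last visit to [p <= M] the path
    stays above it, and the mean value theorem on this excursion forbids an increase. *)
Lemma le_barrier p a b M : a <= b -> {within `[a, b], continuous p} ->
  p a <= M ->
  (forall u, a < u < b -> M < p u ->
     exists2 d, is_derive u 1 p d & d <= 0) ->
  p b <= M.
Proof.
move=> ab cp pa dp; rewrite leNgt; apply/negP => pb.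
have [r [/andP[ar rb] pr rp]] := last_le_itvcc ab cp pa pb.
have cp' : {within `[r, b], continuous p}.
  by apply: continuous_subspaceW cp; apply: subset_itvr; rewrite bnd_simp.
have H u : u \in `]r, b[ -> is_derive u 1 p ((derive1 p) u) /\ (derive1 p) u <= 0.
  rewrite in_itv/= => /andP[ru ub].
  have [||d pd d0] := dp u; first by rewrite ub andbT (le_lt_trans ar).
    by apply: rp; rewrite ru ltW.
  by rewrite derive1E (@derive_val _ _ _ _ _ _ _ pd).
have [c crb pc] := @MVT _ p (derive1 p) r b rb (fun x xr => (H x xr).1) cp'.
have [_ c0] := H _ crb.
have : p b - p r <= 0 by rewrite pc mulr_le0_ge0// subr_ge0 ltW.
lra.
Qed.

Lemma abs_barrier p a b M : a <= b -> {within `[a, b], continuous p} ->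
  `|p a| <= M ->
  (forall u, a < u < b -> M < `|p u| ->
     exists2 d, is_derive u 1 p d & p u * d <= 0) ->
  `|p b| <= M.
Proof.
move=> ab cp pa dp; have M0 : 0 <= M := le_trans (normr_ge0 _) pa.
rewrite ler_norml; move: pa; rewrite ler_norml => /andP[pa1 pa2].
apply/andP; split; last first.
  apply: (le_barrier ab cp) => // u uab Mp.
  have [|d pd pd0] := dp u uab; first by rewrite ltr_normr Mp.
  by exists d => //; rewrite -(pmulr_rle0 _ (le_lt_trans M0 Mp)).
rewrite lerNl; apply: (@le_barrier (\- p) a b) => //=.
- by move=> x; apply: continuousN; exact: cp.
- by rewrite lerNl.
move=> u uab Mp.
have [|d pd pd0] := dp u uab; first by rewrite ltr_normr Mp orbT.
exists (- d); first exact: is_deriveN.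
by rewrite -(pmulr_rle0 _ (le_lt_trans M0 Mp)) mulrNN.
Qed.
End real_functions.
Section comparison_step.
Context {R : realType}.
Variables (alpha beta delta eta : R).
(** The discount factor turns the singular drift of the scheme into [alpha * q / c] with [q]
    slightly below 1, so ordering [c] and [y] does not alone decide the sign. If [p > 0], then
    [y < c] and both terms are nonpositive. If [p < 0], then [y >= c + eta]: for small [y] the gap
    [eta] absorbs [1 - q]; for large [y] the defect of the singular drift is at most
    [alpha * (2 * beta * delta) ^ 2 / eta], which [le_eta] bounds by the linear drift
    [beta * eta]. *)
Lemma drift_dissipative (c y q eps K : R) :
  0 < alpha -> 0 < beta -> 0 <= delta -> 0 <= eta ->
  4 * alpha * beta * delta ^+ 2 <= eta ^+ 2 ->
  0 < c -> 0 < y -> 0 <= q ->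
  1 - 2 * beta * delta <= q <= 1 -> `|eps| <= K ->
  let p : R := c - y + eps in
  K + eta < `|p| -> p * (alpha * (q / c - y^-1) + beta * (y - c)) <= 0.
Proof.
move=> alpha_gt0 beta_gt0 delta_ge0 eta_ge0 le_eta c0 y0 q0 /andP[q1 q2]; rewrite ler_norml => /andP[e1 e2] p.
set r : R := q / c - y^-1.
rewrite ltr_normr => /orP[|] pK.
  have yc : y < c by rewrite /p in pK; lra.
  apply: mulr_ge0_le0; first by lra.
  have r0 : r <= 0.
    rewrite subr_le0 ler_pdivrMr// mulrC ler_pdivlMr//.
    by rewrite (le_trans _ (ltW yc))// ler_piMl// ltW.
  have H1 : 0 <= beta * (c - y) by rewrite mulr_ge0 ?ltW// subr_gt0.
  have := mulr_ge0_le0 (ltW alpha_gt0) r0; lra.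
have yc : c + eta <= y by rewrite /p in pK; lra.
have H2 : beta * eta <= beta * (y - c) by rewrite ler_pM2l//; lra.
apply: mulr_le0_ge0; first by lra.
have [h|h] := leP (2 * beta * delta * y) eta.
  have r0 : 0 <= r.
    rewrite subr_ge0 ler_pdivlMr// mulrC ler_pdivrMr//.
    have : (1 - 2 * beta * delta) * y <= q * y by rewrite ler_wpM2r// ltW.
    lra.
  have := mulr_ge0 (ltW alpha_gt0) r0.
  have := mulr_ge0 (ltW beta_gt0) eta_ge0.
  lra.
have [eta0|eta0] := eqVneq eta 0.
  suff d0 : delta = 0 by move: h; rewrite eta0 d0 mulr0 mul0r ltxx.
  apply/eqP; rewrite -sqrf_eq0 eq_le sqr_ge0 andbT.
  rewrite -(@pmulr_rle0 _ (4 * alpha * beta)) ?mulr_gt0//.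
  by rewrite (le_trans le_eta)// eta0 expr0n.
have {}eta0 : 0 < eta by rewrite lt_def eta0.
have iy : 0 < y^-1 by rewrite invr_gt0.
have H1 : eta * y^-1 <= 2 * beta * delta by rewrite ler_pdivrMr// ltW.
have H3 : (q - 1) * y^-1 <= r.
  have : q / y <= q / c by rewrite ler_wpM2l// lef_pV2// ?posrE//; lra.
  by rewrite /r; set u := q / c; rewrite mulrBl mul1r; lra.
have H4 : - (2 * beta * delta) * y^-1 <= (q - 1) * y^-1.
  by rewrite ler_pM2r//; lra.
have bd0 : 0 <= 2 * beta * delta by rewrite !mulr_ge0// ltW.
have H5 : eta * (2 * beta * delta * y^-1) <= (2 * beta * delta) ^+ 2.
  by rewrite mulrCA expr2 ler_wpM2l.
have H6 : - (2 * beta * delta * y^-1) <= r by rewrite -mulNr (le_trans H4).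
rewrite -(pmulr_rge0 _ eta0) mulrDr.
have H7 : alpha * (eta * (- r)) <= alpha * (2 * beta * delta) ^+ 2.
  by rewrite ler_pM2l// (le_trans _ H5)// ler_pM2l//; lra.
have H8 : beta * (4 * alpha * beta * delta ^+ 2) <= beta * eta ^+ 2.
  by rewrite ler_wpM2l// ltW.
have H9 : eta * (beta * eta) <= eta * (beta * (y - c)) by rewrite ler_wpM2l.
rewrite (_ : eta * (alpha * r) = - (alpha * (eta * - r))); last by ring.
have E1 : alpha * (2 * beta * delta) ^+ 2 = beta * (4 * alpha * beta * delta ^+ 2).
  ring.
have E2 : eta * (beta * eta) = beta * eta ^+ 2 by ring.
lra.
Qed.

(** The bound is a maximum and not a sum: an initial error above [K + eta] is not increased by the
    step. *)
Lemma comparison_step (a b z0 K : R) (Y N : R -> R) :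
  0 < alpha -> 0 < beta -> 0 <= delta -> 0 <= eta ->
  4 * alpha * beta * delta ^+ 2 <= eta ^+ 2 ->
  a <= b -> b - a <= delta ->
  0 <= z0 -> (forall u, a <= u <= b -> 0 < Y u) ->
  {within `[a, b], continuous Y} -> {within `[a, b], continuous N} -> N a = 0 ->
  (forall u, a < u < b ->
     is_derive u 1 (Y - N) (alpha * (Y u)^-1 - beta * Y u)) ->
  (forall u, a <= u <= b -> `|N u| <= K) ->
  `|expR (- beta * (b - a)) * Num.sqrt (z0 ^+ 2 + 2 * alpha * (b - a))
    - Y b + N b| <= Num.max `|z0 - Y a| (K + eta).
Proof.
move=> alpha_gt0 beta_gt0 delta_ge0 eta_ge0 le_eta ab abd z00 Y0 cY cN Na dY NK.
pose c u := expR (- beta * (u - a)) * Num.sqrt (z0 ^+ 2 + 2 * alpha * (u - a)).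
pose p u := c u - (Y - N) u.
have pE v : p v = c v - Y v + N v.
  by rewrite /p; change ((Y - N) v) with (Y v - N v); ring.
have cc v : {for v, continuous c}.
  apply: continuousM.
    apply: continuous_comp; last exact: continuous_expR.
    by apply: continuousM; [exact: cst_continuous|apply: continuousB => //; exact: cst_continuous].
  apply: continuous_comp; last exact: sqrt_continuous.
  apply: continuousD; first exact: cst_continuous.
  by apply: continuousM; [exact: cst_continuous|apply: continuousB => //; exact: cst_continuous].
rewrite -[X in `|X|](pE b).
apply: (@abs_barrier _ p a) => //.
- move=> x; apply: continuousB.
    by apply: continuous_subspaceT => {}x; exact: cc.
  by apply: continuousB; [exact: cY|exact: cN].
- rewrite le_max; apply/orP; left; rewrite pE /c subrr !mulr0 addr0 expR0.
  by rewrite sqrtr_sqr (ger0_norm z00) Na mul1r addr0.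
move=> u /andP[au ub] Mp.
(* [z0] may be 0, so positivity and differentiability of [c] rest on [a < u]. *)
have A0 : 0 < z0 ^+ 2 + 2 * alpha * (u - a).
  by rewrite ltr_wpDl ?sqr_ge0// !mulr_gt0// subr_gt0.
have s0 : 0 < Num.sqrt (z0 ^+ 2 + 2 * alpha * (u - a)) by rewrite sqrtr_gt0.
have c0 : 0 < c u by rewrite mulr_gt0 ?expR_gt0.
pose q := expR (- beta * (u - a)) ^+ 2.
have duB : is_derive u 1 (fun u => u - a) 1.
  apply: is_derive_eq. by rewrite subr0.
have dc : is_derive u 1 c (alpha * (q / c u) - beta * c u).
  have d1 : is_derive u 1 (fun u => expR (- beta * (u - a)))
      (expR (- beta * (u - a)) * - beta).
    apply: is_derive1_comp; apply: is_derive_eq. by rewrite /GRing.scale /= mulr1.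
  have d2 : is_derive u 1 (fun u => Num.sqrt (z0 ^+ 2 + 2 * alpha * (u - a)))
      ((2 * Num.sqrt (z0 ^+ 2 + 2 * alpha * (u - a)))^-1 * (2 * alpha)).
    have dg : is_derive u 1 (fun u => z0 ^+ 2 + 2 * alpha * (u - a)) (2 * alpha).
      by apply: is_derive_eq; rewrite /GRing.scale /=; ring.
    exact: (@is_derive1_comp _ Num.sqrt _ u _ _ (is_derive1_sqrt A0) dg).
  apply: is_derive_eq.
  rewrite /q /c /GRing.scale/=; move: (expR_gt0 (- beta * (u - a))) s0.
  set E := expR _; set S := Num.sqrt _ => E0 S0.
  by field; rewrite !gt_eqF.
exists (alpha * (q / c u - (Y u)^-1) + beta * (Y u - c u)).
  have dYN := dY u _; rewrite au ub in dYN; have {}dYN := dYN isT.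
  apply: is_derive_eq.
  by ring.
have Yu : 0 < Y u by apply: Y0; rewrite !ltW.
have q0 : 0 <= q by exact: sqr_ge0.
have q1 : 1 - 2 * beta * delta <= q <= 1.
  rewrite /q -expRM_natl; apply/andP; split.
    have bd : beta * (u - a) <= beta * delta by rewrite ler_pM2l//; lra.
    apply: le_trans (expR_ge1Dx (2 * (- beta * (u - a)))).
    by have : 1 - 2 * beta * delta <= 1 + 2 * (- beta * (u - a)) by lra.
  rewrite -[leRHS]expR0 ler_expR.
  have : 0 <= beta * (u - a) by rewrite mulr_ge0 ?subr_ge0// ltW.
  lra.
have Nu : `|N u| <= K by apply: NK; rewrite !ltW.
rewrite pE.
apply: (drift_dissipative alpha_gt0 beta_gt0 delta_ge0 eta_ge0 le_eta c0 Yu q0 q1 Nu).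
by rewrite -pE; apply: le_lt_trans Mp; rewrite le_max lexx orbT.
Qed.
End comparison_step.

(** * Accumulated error of the scheme along a path *)

Section scheme_error.
Context {R : realType}.
Variables (alpha beta gamma : R).

(** The scheme discounts the noise of the step, whereas [comparison_step] adds it in full; the
    mismatch [(1 - E) * N s] is the term [beta * K * (s - a)]. The square root sees only [|z|], and
    since [Y a > 0], replacing [z] by [|z|] does not increase the error. *)
Lemma scheme_step_error (delta eta K a s z Da : R) (Y w : R -> R) :
  0 < alpha -> 0 < beta -> 0 <= delta -> 0 <= eta ->
  4 * alpha * beta * delta ^+ 2 <= eta ^+ 2 ->
  a <= s -> s - a <= delta ->
  (forall u, a <= u <= s -> 0 < Y u) ->
  {within `[a, s], continuous Y} -> {within `[a, s], continuous w} ->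
  (forall u, a < u < s ->
     is_derive u 1 (fun v => Y v - gamma * w v)
       (alpha * (Y u)^-1 - beta * Y u)) ->
  (forall u, a <= u <= s -> `|gamma * (w u - w a)| <= K) ->
  `|z - Y a| <= Da -> K + eta <= Da ->
  `|expR (- beta * (s - a)) *
     (Num.sqrt (z ^+ 2 + 2 * alpha * (s - a)) + gamma * (w s - w a)) - Y s|
  <= Da + beta * K * (s - a).
Proof.
move=> alpha_gt0 beta_gt0 delta_ge0 eta_ge0 le_eta le_as sa Y0 cY cw dY wK zD KD.
have K0 : 0 <= K.
  by apply: le_trans (wK a _) => //; rewrite lexx.
have Ya : 0 < Y a by apply: Y0; rewrite lexx.
have zD' : `| `|z| - Y a| <= Da.
  apply: le_trans zD; rewrite -{1}(ger0_norm (ltW Ya)); exact: ler_dist_dist.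
pose N u := gamma * (w u - w a).
have cN : {within `[a, s], continuous N}.
  move=> x; apply: cvgM; first exact: cvg_cst.
  by apply: cvgB; [exact: cw|exact: cvg_cst].
have Na : N a = 0 by rewrite /N subrr mulr0.
have dYN u : a < u < s ->
    is_derive u 1 (Y - N) (alpha * (Y u)^-1 - beta * Y u).
  move=> uas; have dYu := dY u uas.
  have -> : Y - N = (fun v => Y v - gamma * w v) + cst (gamma * w a).
    by apply/funext => v; rewrite /N -![(_ - _ : _ -> _) _]/(_ - _) -![(_ + _ : _ -> _) _]/(_ + _) /=; ring.
  by apply: is_derive_eq; rewrite addr0.
have := comparison_step alpha_gt0 beta_gt0 delta_ge0 eta_ge0 le_eta le_as sa
  (normr_ge0 z) Y0 cY cN Na dYN wK.
rewrite real_normK ?num_real//.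
set E := expR _; set S := Num.sqrt _.
move=> H.
have {}H : `|E * S - Y s + N s| <= Da by rewrite (le_trans H)// ge_max zD' KD.
have E1 : E <= 1.
  by rewrite -[leRHS]expR0 ler_expR mulNr oppr_le0 mulr_ge0 ?subr_ge0// ltW.
have E2 : 1 - beta * (s - a) <= E.
  by apply: le_trans (expR_ge1Dx _); rewrite mulNr.
have -> : E * (S + gamma * (w s - w a)) - Y s
    = (E * S - Y s + N s) - (1 - E) * N s by rewrite /N; ring.
rewrite (le_trans (ler_normB _ _))// lerD// normrM.
have -> : beta * K * (s - a) = beta * (s - a) * K by ring.
apply: ler_pM => //; first by rewrite ger0_norm; lra.
by apply: wK; rewrite lexx le_as.
Qed.

(** The bound at [t n] is already at least [K + eta], so each step adds only the discounting
    mismatch, and these sum to [beta * K * t n] whatever the number of steps. *)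
Lemma scheme_error (delta eta K T : R) (m : nat) (t S : nat -> R) (Y w : R -> R) :
  0 < alpha -> 0 < beta -> 0 <= delta -> 0 <= eta ->
  4 * alpha * beta * delta ^+ 2 <= eta ^+ 2 ->
  t 0%N = 0 -> t m <= T ->
  (forall n, (n < m)%N -> 0 <= t n.+1 - t n <= delta) ->
  (forall n, S n.+1 = expR (- beta * (t n.+1 - t n)) *
     (Num.sqrt (S n ^+ 2 + 2 * alpha * (t n.+1 - t n))
      + gamma * (w (t n.+1) - w (t n)))) ->
  S 0%N = Y 0 ->
  (forall u, 0 <= u <= T -> 0 < Y u) ->
  {within `[0, T], continuous Y} -> {within `[0, T], continuous w} ->
  (forall u, 0 < u < T ->
     is_derive u 1 (fun v => Y v - gamma * w v)
       (alpha * (Y u)^-1 - beta * Y u)) ->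
  (forall s u, 0 <= s <= T -> 0 <= u <= T -> `|s - u| <= delta ->
     `|gamma * (w s - w u)| <= K) ->
  `|S m - Y (t m)| <= K + eta + beta * K * t m /\
  forall s, t m <= s <= T -> s - t m <= delta ->
    `|expR (- beta * (s - t m)) *
       (Num.sqrt (S m ^+ 2 + 2 * alpha * (s - t m)) + gamma * (w s - w (t m)))
      - Y s| <= K + eta + beta * K * s.
Proof.
move=> alpha_gt0 beta_gt0 delta_ge0 eta_ge0 le_eta t0 tmT dt SS S0 Y0 cY cw dY wK.
have t_ge0 n : (n <= m)%N -> 0 <= t n.
  elim: n => [|n IH] nm; first by rewrite t0.
  by have /andP[+ _] := dt n nm; rewrite subr_ge0; apply: le_trans; apply/IH/ltnW.
have t_leT n : (n <= m)%N -> t n <= T.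
  move=> nm; rewrite -(subKn nm); elim: (m - n)%N (leq_subr n m) => [|k IH] km.
    by rewrite subn0.
  apply: le_trans (IH (ltnW km)); rewrite -subr_ge0.
  have lt_m : (m - k.+1 < m)%N by rewrite ltn_subrL (leq_ltn_trans _ km).
  by have := dt _ lt_m; rewrite subnSK// => /andP[].
have T_ge0 : 0 <= T by rewrite -t0; exact: t_leT.
have K0 : 0 <= K.
  by apply: le_trans (wK 0 0 _ _ _) => //; rewrite ?lexx// subrr normr0.
have step n : (n <= m)%N -> `|S n - Y (t n)| <= K + eta + beta * K * t n ->
    forall s, t n <= s <= T -> s - t n <= delta ->
    `|expR (- beta * (s - t n)) *
       (Num.sqrt (S n ^+ 2 + 2 * alpha * (s - t n)) + gamma * (w s - w (t n)))
      - Y s| <= K + eta + beta * K * s.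
  move=> nm IH s /andP[ts sT] sd; have tn0 := t_ge0 n nm.
  have sub : `[t n, s]%classic `<=` `[0, T]%classic.
    by apply: subset_itv; rewrite bnd_simp.
  have -> : K + eta + beta * K * s =
      K + eta + beta * K * t n + beta * K * (s - t n) by ring.
  apply: (scheme_step_error alpha_gt0 beta_gt0 delta_ge0 eta_ge0 le_eta) => //.
  - by move=> u /andP[u1 u2]; apply: Y0; rewrite (le_trans tn0 u1) (le_trans u2 sT).
  - exact: continuous_subspaceW cY.
  - exact: continuous_subspaceW cw.
  - by move=> u /andP[u1 u2]; apply: dY; rewrite (le_lt_trans tn0 u1) (lt_le_trans u2 sT).
  - move=> u /andP[u1 u2]; apply: wK.
    + by rewrite (le_trans tn0 u1) (le_trans u2 sT).
    + by rewrite tn0 t_leT.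
    + by rewrite ger0_norm ?subr_ge0//; lra.
  - by rewrite lerDl !mulr_ge0// ltW.
have H n : (n <= m)%N -> `|S n - Y (t n)| <= K + eta + beta * K * t n.
  elim: n => [|n IH] nm.
    by rewrite t0 S0 subrr normr0 mulr0 addr0 addr_ge0.
  have /andP[d1 d2] := dt n nm.
  by rewrite SS; apply: step => //; [exact: ltnW|exact/IH/ltnW|rewrite -subr_ge0 d1 t_leT].
by split; [exact: H|exact/step/H].
Qed.
End scheme_error.

(** * Paths of the equation and their approach to zero *)

Section sde_path.
Context {R : realType}.
Variables (alpha beta gamma : R).
Implicit Types (Y w : R -> R) (T : R).

Lemma eps_within_itvcc (p : R -> R) (a b : R) :
  (forall x, a <= x <= b -> forall e, 0 < e -> exists2 d, 0 < d &
    forall y, a <= y <= b -> `|x - y| < d -> `|p x - p y| < e) ->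
  {within `[a, b], continuous p}.
Proof.
move=> H; apply/subspace_continuousP => x /=; rewrite in_itv/= => xab.
apply/cvgrPdist_lt => e e0; rewrite near_withinE; apply/nbhs_ballP.
have [d d0 Hd] := H x xab e e0.
by exists d => //= y xy; rewrite in_itv/= => yab; exact: Hd.
Qed.

(** Time reversal turns the first nonpositive time into the last time given by [last_le_itvcc]. *)
Lemma first_nonpos (p : R -> R) (b : R) : {within `[0, b], continuous p} ->
  0 <= b -> 0 < p 0 -> p b <= 0 ->
  exists tau, [/\ 0 < tau <= b, p tau <= 0 & forall t, 0 <= t < tau -> 0 < p t].
Proof.
move=> cp b0 p0 pb; pose q v := p (b - v).
have cq : {within `[0, b], continuous q}.
  apply: eps_within_itvcc => x /andP[x0 xb] e e0.
  have bx : 0 <= b - x <= b by rewrite subr_ge0 xb lerBlDr lerDl x0.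
  have [d d0 H] := within_itvcc_eps cp bx e0.
  exists d => // y /andP[y0 yb] xy; apply: H.
    by rewrite subr_ge0 yb lerBlDr lerDl y0.
  by rewrite (_ : b - x - (b - y) = - (x - y)) ?normrN//; ring.
have [||r [/andP[r0 rb] qr H]] := last_le_itvcc b0 cq (M := 0).
- by rewrite /q subr0.
- by rewrite /q subrr.
exists (b - r); split => //.
  by rewrite subr_gt0 rb lerBlDr lerDl r0.
move=> t /andP[t0 tr]; rewrite (_ : t = b - (b - t)); last by ring.
by apply: H; apply/andP; split; lra.
Qed.

(** Without the noise the path is a constant plus the integral of the drift. The drift is continuous
    at [u] because [Y u > 0], so the fundamental theorem of calculus applies there even if [Y]
    vanishes elsewhere. *)
Lemma is_derive_sde_path (T T' u Y0 : R) Y w :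
  let f s := alpha * (Y s)^-1 - beta * Y s in
  {within `[0, T], continuous Y} ->
  lebesgue_measure.-integrable `[0, T] (EFin \o f) ->
  (forall t, 0 <= t <= T ->
     Y t = Y0 + \int[lebesgue_measure]_(s in `[0, t]) f s + gamma * (w t - w 0)) ->
  T' <= T -> 0 < u < T' -> 0 < Y u ->
  is_derive u 1 (fun v => Y v - gamma * w v) (f u).
Proof.
move=> f cY intf YE TT /andP[u0 uT'] Yu.
have uT : u < T := lt_le_trans uT' TT.
have cYu : {for u, continuous Y}.
  move/continuous_within_itvP : cY => [|+ _ _]; first exact: lt_trans uT.
  by apply; rewrite in_itv/= u0 uT.
have cf : {for u, continuous f}.
  apply: cvgB; (apply: cvgM; first exact: cvg_cst) => //.
  by apply: cvgV => //; rewrite gt_eqF.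
have [dF FE] := @continuous_FTC1_closed _ f 0 u T uT intf u0 cf.
set F := (fun x : R => _) in dF FE.
have dF' : is_derive u 1 F (f u) by rewrite -FE derive1E; exact: derivableP.
apply: (@near_eq_is_derive _ _ _ (cst (Y0 - gamma * w 0) + F)); last 2 first.
- have : u \in `]0, T[ by rewrite in_itv/= u0 uT.
  move=> /near_in_itvoo; apply: filterS => v; rewrite in_itv/= => /andP[v0 vT].
  rewrite YE; last by rewrite !ltW.
  by rewrite -[(_ + _ : _ -> _) _]/(_ + _) /= /F; ring.
- by apply: is_derive_eq; rewrite add0r.
Qed.

(** Before [tau] the singular term is nonnegative, so the drift is at least [- (beta * M)] and only
    the noise can bring the path down faster. The mean value theorem asks for mere continuity at
    [tau], where the drift may blow up. *)
Lemma near_first_zero (M tau t : R) Y w : 0 <= alpha -> 0 <= beta ->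
  {within `[0, tau], continuous Y} -> {within `[0, tau], continuous w} ->
  (forall u, 0 < u < tau ->
     is_derive u 1 (fun v => Y v - gamma * w v) (alpha * (Y u)^-1 - beta * Y u)) ->
  Y tau <= 0 -> (forall t, 0 <= t < tau -> 0 < Y t <= M) ->
  0 <= t < tau -> Y t <= beta * M * (tau - t) + `|gamma * (w tau - w t)|.
Proof.
move=> a0 b0 cY cw dY Ytau Y0 /andP[t0 tt].
have cU : {within `[t, tau], continuous (fun v => Y v - gamma * w v)}.
  have sub : `[t, tau]%classic `<=` `[0, tau]%classic.
    by apply: subset_itv; rewrite bnd_simp.
  move=> x; apply: cvgB; first exact: (continuous_subspaceW sub cY).
  by apply: cvgM; [exact: cvg_cst|exact: (continuous_subspaceW sub cw)].
have dU x : x \in `]t, tau[ -> is_derive x 1 (fun v => Y v - gamma * w v)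
    (alpha * (Y x)^-1 - beta * Y x).
  by rewrite in_itv/= => /andP[tx xt]; apply: dY; rewrite xt (le_lt_trans t0).
have [c] := MVT tt dU cU.
rewrite in_itv/= => /andP[tc ct] E.
have /andP[Yc YM] : 0 < Y c <= M.
  by apply: Y0; rewrite ct (le_trans t0)// ltW.
have H1 : - (beta * M) <= alpha * (Y c)^-1 - beta * Y c.
  have h1 : 0 <= alpha * (Y c)^-1 by rewrite mulr_ge0// invr_ge0 ltW.
  have h2 : beta * Y c <= beta * M by rewrite ler_wpM2l.
  lra.
have H2 : - (beta * M) * (tau - t) <= Y tau - gamma * w tau - (Y t - gamma * w t).
  by rewrite E ler_wpM2r// subr_ge0 ltW.
have H3 : - (gamma * (w tau - w t)) <= `|gamma * (w tau - w t)|.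
  by rewrite -normrN ler_norm.
have {}H3 : - (gamma * w tau) + gamma * w t <= `|gamma * (w tau - w t)| by lra.
lra.
Qed.
End sde_path.
(** * A path which reaches zero *)

Section hitting_zero.
Context {R : realType}.
Variables (alpha beta gamma Y0 : R).

Fixpoint unif_scheme (h : R) (w : R -> R) (n : nat) : R :=
  match n with
  | 0 => Y0
  | m.+1 => expR (- beta * h) *
      (Num.sqrt (unif_scheme h w m ^+ 2 + 2 * alpha * h)
       + gamma * (w (m.+1%:R * h) - w (m%:R * h)))
  end.

(* Hoelder continuity with exponent [log2 (5 / 4)], between [1/4] and [1/3]: the
   lower bound, [2 (4 / 5) ^ 4 < 1], gives the rate of convergence and
   positivity; the upper bound, [4 (4 / 5) ^ 6 > 1], makes sixth moments
   sufficient. *)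
Definition dyadic_modulus (T L : R) (w : R -> R) :=
  forall j s u, 0 <= s <= T -> 0 <= u <= T -> `|s - u| <= T / 2 ^+ j ->
    `|w s - w u| <= L * (4 / 5) ^+ j.

(** The exponent [2 * j] gives [h <= T * e ^ 2] for [e = (4 / 5) ^ (2 * j)], since
    [1 / 4 <= (4 / 5) ^ 4]. The extra halving puts [2 * 2 ^ j] steps into a window [T / 2 ^ j],
    twice as many as are used. *)
Definition level_mesh (T : R) (j : nat) : R := T / 2 ^+ (2 * j).+1.

(* A Riemann sum for the integral of [S ^ -4], regularized by [(4 / 5) ^ (2 j)],
   which is the size of [S ^ 2] at distance [T / 2 ^ j] before the first zero. *)
Definition level_sum (T : R) (w : R -> R) (j : nat) : R :=
  let h := level_mesh T j in
  \sum_(0 <= k < 2 ^ (2 * j).+1)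
    h / (unif_scheme h w k ^+ 2 + (4 / 5) ^+ (2 * j) + 2 * alpha * h) ^+ 2.

(** The [2 ^ j] mesh points just before the zero contribute at least [h / (D * a ^ (2 * j)) ^ 2]
    each, with [a = 4 / 5] and [2 ^ j * h = T / 2 / 2 ^ j]. Hence the growth rate
    [(2 * a ^ 4)^-1 = 625 / 512]. *)
Lemma level_sum_hit (T L : R) (Y w : R -> R) :
  let f s := alpha * (Y s)^-1 - beta * Y s in
  0 < alpha -> 0 < beta -> 0 <= gamma -> 0 < Y0 -> 0 < T -> 0 <= L ->
  {within `[0, T], continuous Y} -> {within `[0, T], continuous w} ->
  lebesgue_measure.-integrable `[0, T] (EFin \o f) ->
  (forall t, 0 <= t <= T ->
     Y t = Y0 + \int[lebesgue_measure]_(s in `[0, t]) f s + gamma * (w t - w 0)) ->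
  dyadic_modulus T L w ->
  (exists2 t, 0 <= t <= T & Y t <= 0) ->
  exists2 c, 0 < c & exists j0, forall j, (j0 <= j)%N ->
    c * (625 / 512) ^+ j <= level_sum T w j.
Proof.
move=> f alpha0 beta0 gamma0 Y00 T0 L0 cY cw intf YE wL [t1 /andP[t10 t1T] Yt1].
have YY0 : Y 0 = Y0.
  by rewrite YE ?lexx ?ltW// set_itv1 Rintegral_set1 subrr mulr0 !addr0.
have sub b : b <= T -> `[0, b]%classic `<=` `[0, T]%classic.
  by move=> bT; apply: subset_itvl; rewrite bnd_simp.
have [||tau [/andP[tau0 taut1] Ytau Ypos]] :=
    first_nonpos (continuous_subspaceW (sub _ t1T) cY) t10.
- by rewrite YY0.
- exact: Yt1.
have tauT : tau <= T := le_trans taut1 t1T.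
have [tM tM1 YM] := EVT_max (ltW T0) cY.
set M := Y tM in YM.
have M0 : 0 < M.
  by apply: lt_le_trans (YM 0 _); [rewrite YY0|rewrite in_itv/= lexx ltW].
have dY T' : T' <= tau -> forall u, 0 < u < T' ->
    is_derive u 1 (fun v => Y v - gamma * w v) (alpha * (Y u)^-1 - beta * Y u).
  move=> T't u /andP[u0 uT'].
  apply: (is_derive_sde_path cY intf YE (le_trans T't tauT)); first by rewrite u0.
  by apply: Ypos; rewrite ltW//= (lt_le_trans uT').
pose a : R := 4 / 5.
have a0 : 0 < a by rewrite /a; lra.
have a1 : a < 1 by rewrite /a; lra.
(* Coefficients of [a ^ j] in the bound of [|S k|]: the first two terms bound [Y] near [tau], the
   other three are [K], [eta] and the accumulated [beta * K * T] of [scheme_error]. *)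
pose C := beta * M * T + gamma * L + gamma * L + 2 * (alpha + beta) * T + beta * (gamma * L) * T.
have C0 : 0 <= C by rewrite /C !addr_ge0 ?mulr_ge0 ?addr_ge0// ?ltW.
pose D := C ^+ 2 + 1 + 2 * alpha * T.
have D0 : 0 < D by rewrite /D ltr_wpDr ?mulr_ge0 ?ltW// ltr_wpDl ?sqr_ge0.
pose c := T / 2 / D ^+ 2.
exists c; first by rewrite /c !divr_gt0 ?exprn_gt0.
(* From level [j0] on, the window before the zero fits into [[0, tau]]. *)
have [j0 Hj0] : exists j0, forall j, (j0 <= j)%N -> T / 2 ^+ j <= tau.
  exists (Num.truncn (T / tau)).+1 => j nj.
  rewrite ler_pdivrMr ?exprn_gt0// mulrC -ler_pdivrMr//.
  apply: ltW; apply: lt_le_trans (truncnS_gt _) _.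
  rewrite -natrX ler_nat (leq_trans nj)// ltnW// ltn_expl//.
exists j0 => j j0j.
set h := level_mesh T j.
have h0 : 0 < h by rewrite /h /level_mesh divr_gt0// exprn_gt0.
have hE : h * (2 ^+ j * 2) = T / 2 ^+ j.
  by rewrite /h /level_mesh exprSr mul2n -addnn exprD; field; rewrite expf_neq0.
have mh : (2 ^ (2 * j).+1)%N%:R * h = T.
  by rewrite natrX /h /level_mesh; field; rewrite expf_neq0.
have a2 : (2 ^+ j)^-1 <= a ^+ j.
  by rewrite -exprVn lerXn2r ?nnegrE ?ltW ?invr_gt0// /a; lra.
have a3 : h <= T * a ^+ (2 * j).
  rewrite /h /level_mesh ler_pM2l// exprS invfM.
  have a22 : (2 ^+ (2 * j))^-1 <= a ^+ (2 * j).
    by rewrite -exprVn lerXn2r ?nnegrE ?ltW ?invr_gt0// /a; lra.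
  apply: le_trans a22; rewrite ler_piMl ?invr_ge0 ?exprn_ge0//; lra.
have a4 : a ^+ (2 * j).+1 <= a ^+ j.
  by rewrite ler_wiXn2l ?ltW// mul2n -addnn -addnS leq_addr.
have aj0 : 0 < a ^+ j by rewrite exprn_gt0.
pose S := unif_scheme h w.
have SC k : k%:R * h < tau -> tau - k%:R * h <= T / 2 ^+ j -> `|S k| <= C * a ^+ j.
  move=> kt tk; pose tk' := k%:R * h.
  have tk0 : 0 <= tk' by rewrite mulr_ge0// ltW.
  have tkT : tk' <= T by rewrite (le_trans (ltW kt)).
  have Y1 : Y tk' <= beta * M * (tau - tk') + `|gamma * (w tau - w tk')|.
    apply: (@near_first_zero _ alpha beta gamma M tau tk' Y w).
    - exact: ltW.
    - exact: ltW.
    - exact: continuous_subspaceW (sub _ tauT) cY.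
    - exact: continuous_subspaceW (sub _ tauT) cw.
    - exact: dY.
    - exact: Ytau.
    - move=> t /andP[t0 tt]; rewrite Ypos ?t0//=; apply: YM.
      by rewrite in_itv/= t0 (le_trans (ltW tt)).
    - by rewrite tk0 kt.
  have Y2 : `|gamma * (w tau - w tk')| <= gamma * L * a ^+ j.
    rewrite normrM (ger0_norm gamma0) -mulrA ler_wpM2l//; apply: wL.
    - by rewrite ltW.
    - by rewrite tk0.
    - by rewrite ger0_norm// subr_ge0 ltW.
  have Y3 : beta * M * (tau - tk') <= beta * M * T * a ^+ j.
    have tT : tau - tk' <= T * a ^+ j by rewrite (le_trans tk)// ler_pM2l.
    by rewrite -[leRHS]mulrA; apply: ler_wpM2l => //; rewrite mulr_ge0// ltW.
  pose K := gamma * L * a ^+ j.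
  have K0 : 0 <= K by rewrite /K !mulr_ge0// ltW.
  (* A multiple of [h] satisfying [le_eta], because [alpha * beta <= (alpha + beta) ^ 2]. *)
  pose eta := 2 * (alpha + beta) * h.
  have eta0 : 0 <= eta by rewrite /eta !mulr_ge0 ?addr_ge0// ltW.
  have Ytk : 0 < Y tk' by apply: Ypos; rewrite tk0.
  have le_eta : 4 * alpha * beta * h ^+ 2 <= eta ^+ 2.
    rewrite /eta [leRHS]exprMn ler_wpM2r ?sqr_ge0//.
    have : 0 <= (alpha - beta) ^+ 2 by exact: sqr_ge0.
    have := mulr_gt0 alpha0 beta0.
    lra.
  have dt n : (n < k)%N -> 0 <= n.+1%:R * h - n%:R * h <= h.
    by move=> _; rewrite -mulrBl -natrB// subSnn mul1r lexx ltW.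
  have SS n : S n.+1 = expR (- beta * (n.+1%:R * h - n%:R * h)) *
     (Num.sqrt (S n ^+ 2 + 2 * alpha * (n.+1%:R * h - n%:R * h))
      + gamma * (w (n.+1%:R * h) - w (n%:R * h))).
    by rewrite -mulrBl -natrB// subSnn mul1r.
  have Ytk'' u : 0 <= u <= tk' -> 0 < Y u.
    by move=> /andP[u0 ut]; apply: Ypos; rewrite u0 (le_lt_trans ut).
  have wK s u : 0 <= s <= tk' -> 0 <= u <= tk' -> `|s - u| <= h ->
      `|gamma * (w s - w u)| <= K.
    move=> /andP[s0 st] /andP[u0 ut] su.
    rewrite normrM (ger0_norm gamma0) /K -mulrA ler_wpM2l//.
    have sT : 0 <= s <= T by rewrite s0 (le_trans st).
    have uT : 0 <= u <= T by rewrite u0 (le_trans ut).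
    by rewrite (le_trans (wL _ _ _ sT uT su))// ler_wpM2l.
  (* The horizon is [tk'] and not [T]: positivity is known only before [tau]. *)
  have [+ _] := @scheme_error _ _ _ _ h eta K tk' k (fun n => n%:R * h) S Y w
    alpha0 beta0 (ltW h0) eta0 le_eta (mul0r h) (lexx _) dt SS (esym YY0) Ytk''
    (continuous_subspaceW (sub _ tkT) cY) (continuous_subspaceW (sub _ tkT) cw)
    (dY _ (ltW kt)) wK.
  rewrite -/tk' => H.
  have H1 : `|S k| <= Y tk' + (K + eta + beta * K * tk').
    rewrite -{1}(subrK (Y tk') (S k)) addrC (le_trans (ler_normD _ _))//.
    by rewrite (gtr0_norm Ytk) lerD2l.
  have H2 : eta <= 2 * (alpha + beta) * T * a ^+ j.
    rewrite /eta -[leRHS]mulrA ler_pM2l ?mulr_gt0 ?addr_gt0//.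
    rewrite (le_trans a3)// ler_pM2l//.
    by apply: ler_wiXn2l; [exact: ltW|exact: ltW|rewrite leq_pmull].
  have H3 : beta * K * tk' <= beta * (gamma * L) * T * a ^+ j.
    rewrite (_ : _ * a ^+ j = beta * K * T); last by rewrite /K; ring.
    by rewrite ler_wpM2l// mulr_ge0// ltW.
  have -> : C * a ^+ j = beta * M * T * a ^+ j + gamma * L * a ^+ j + gamma * L * a ^+ j
     + 2 * (alpha + beta) * T * a ^+ j + beta * (gamma * L) * T * a ^+ j by rewrite /C; ring.
  rewrite -/K in Y2 *; lra.
have term k : k%:R * h < tau -> tau - k%:R * h <= T / 2 ^+ j ->
    h / (D * a ^+ (2 * j)) ^+ 2 <=
    h / (S k ^+ 2 + (4 / 5) ^+ (2 * j) + 2 * alpha * h) ^+ 2.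
  move=> kt tk; rewrite ler_pM2l//.
  have A0 : 0 < S k ^+ 2 + a ^+ (2 * j) + 2 * alpha * h.
    by rewrite ltr_wpDr ?mulr_ge0 ?ltW// ltr_wpDl ?sqr_ge0// exprn_gt0.
  have aj20 : 0 < a ^+ (2 * j) by rewrite exprn_gt0.
  rewrite lef_pV2 ?posrE ?exprn_gt0 ?mulr_gt0//.
  apply: lerXn2r; rewrite ?nnegrE.
  - exact: ltW.
  - by rewrite ltW ?mulr_gt0.
  have -> : D * a ^+ (2 * j) = (C * a ^+ j) ^+ 2 + a ^+ (2 * j) + 2 * alpha * (T * a ^+ (2 * j)).
    by rewrite (mulnC 2) exprM /D; ring.
  rewrite lerD// ?lerD2r.
    rewrite -(real_normK (num_real (S k))); apply: lerXn2r; rewrite ?nnegrE//.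
      by rewrite mulr_ge0// ltW.
    exact: SC.
  by rewrite ler_pM2l ?mulr_gt0.
pose n1 := Num.truncn (tau / h).
have /andP[n1a n1b] : n1%:R <= tau / h < n1.+1%:R.
  by apply: truncn_itv; rewrite divr_ge0 ?ltW.
have {}n1a : n1%:R * h <= tau by rewrite -ler_pdivlMr.
have {}n1b : tau < n1.+1%:R * h by rewrite -ltr_pdivrMr.
have pn1 : (2 ^ j <= n1)%N.
  have : (2 ^ j * 2)%:R * h < n1.+1%:R * h.
    apply: le_lt_trans n1b; rewrite natrM natrX mulrC hE; exact: Hj0.
  rewrite ltr_pM2r// ltr_nat ltnS; apply: leq_trans.
  by rewrite leq_pmulr.
have n1m : (n1 <= 2 ^ (2 * j).+1)%N.
  by rewrite -(ler_nat R) -(ler_pM2r h0) mh (le_trans n1a).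
rewrite /level_sum -/h.
(* Only the indices from [n1 - 2 ^ j] up to [n1], excluded, are kept. Excluding [n1] keeps the mesh
   points strictly before [tau]. *)
rewrite (big_cat_nat (leq0n n1) n1m)/=.
rewrite (big_cat_nat (leq0n (n1 - 2 ^ j)) (leq_subr (2 ^ j) n1))/=.
have tge0 k : 0 <= h / (S k ^+ 2 + (4 / 5) ^+ (2 * j) + 2 * alpha * h) ^+ 2.
  by rewrite divr_ge0 ?sqr_ge0// ltW.
rewrite -[leLHS]addr0 lerD ?sumr_ge0//.
rewrite -[leLHS]add0r lerD ?sumr_ge0//.
have -> : c * (625 / 512) ^+ j =
    \sum_(n1 - 2 ^ j <= k < n1) h / (D * a ^+ (2 * j)) ^+ 2.
  rewrite sumr_const_nat subKn// -[RHS]mulr_natl natrX.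
  have -> : 2 ^+ j * (h / (D * a ^+ (2 * j)) ^+ 2) =
     (h * (2 ^+ j * 2)) / 2 / (D * a ^+ (2 * j)) ^+ 2.
    by move: (_ ^-1) => X; field.
  rewrite hE /c.
  have -> : (625 / 512 : R) = (2 * a ^+ 4)^-1 by rewrite /a; field.
  have -> : (2 * a ^+ 4)^-1 ^+ j = (2 ^+ j * (a ^+ (2 * j)) ^+ 2)^-1.
    by rewrite exprVn exprMn -!exprM (_ : (2 * j * 2 = 4 * j)%N)// mulnAC.
  have : a ^+ (2 * j) != 0 by rewrite gt_eqF// exprn_gt0.
  have : 2 ^+ j != 0 :> R by rewrite expf_neq0.
  move: (a ^+ (2 * j)) (2 ^+ j) => X Z Z0 X0.
  by field; rewrite X0 Z0 gt_eqF.
apply: ler_sum_nat => k /andP[k1 k2].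
have kt : k%:R * h < tau.
  by apply: lt_le_trans n1a; rewrite ltr_pM2r// ltr_nat.
apply: term => //.
(* The spare [2 ^ j] steps absorb the rounding of [tau] up to [n1.+1], so that [k] lies in the
   window. *)
have : n1.+1%:R * h <= (2 ^ j * 2 + k)%:R * h.
  rewrite ler_pM2r// ler_nat muln2 -addnn -addnA -(addn1 n1) addnC.
  apply: leq_add; first by rewrite expn_gt0.
  by rewrite -leq_subLR.
rewrite natrD mulrDl natrM natrX (mulrC (2 ^+ j * 2)) hE; lra.
Qed.
End hitting_zero.
(** * Gaussian estimates and the regularity of Wiener paths *)

Section chaining.
Context {R : realType}.

(** Each time is the limit of its roundings down to finer grids, and consecutive roundings are equal
    or adjacent on the finer grid. The tail of the geometric series beyond level [j] is
    [4 * (4 / 5) ^ j]; two such tails and one step at level [j] give [9 = 4 + 1 + 4]. *)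
Lemma dyadic_chaining (T L : R) (w : R -> R) : 0 < T -> 0 <= L ->
  {within `[0, T], continuous w} ->
  (forall l i, (i < 2 ^ l)%N ->
     `|w (i.+1%:R * (T / 2 ^+ l)) - w (i%:R * (T / 2 ^+ l))| <= L * (4 / 5) ^+ l) ->
  dyadic_modulus T (9 * L) w.
Proof.
move=> T0 L0 cw wL.
pose a : R := 4 / 5.
have a0 : 0 < a by rewrite /a; lra.
pose g l : R := T / 2 ^+ l.
have g0 l : 0 < g l by rewrite /g divr_gt0// exprn_gt0.
have gS l : g l = 2 * g l.+1.
  by rewrite /g exprS; field; rewrite expf_neq0.
pose idx l s : nat := Num.truncn (s / g l).
have idxP l (s : R) : 0 <= s -> (idx l s)%:R * g l <= s < (idx l s).+1%:R * g l.
  move=> s0; have /andP[] := @truncn_itv _ (s / g l) (divr_ge0 s0 (ltW (g0 l))).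
  by rewrite ler_pdivlMr// ltr_pdivrMr// => -> ->.
have idxle l (s : R) : 0 <= s <= T -> (idx l s <= 2 ^ l)%N.
  move=> /andP[s0 sT]; rewrite -(ler_nat R) natrX -(ler_pM2r (g0 l)).
  have /andP[+ _] := idxP l s s0; move=> /le_trans; apply.
  by rewrite /g mulrCA divff ?mulr1// expf_neq0.
pose fl l s := (idx l s)%:R * g l.
have adj l (m n : nat) : (m <= n)%N -> (n <= m.+1)%N -> (n <= 2 ^ l)%N ->
    `|w (n%:R * g l) - w (m%:R * g l)| <= L * a ^+ l.
  move=> mn nm n2; have [->|mneq] := eqVneq n m.
    by rewrite subrr normr0 mulr_ge0// exprn_ge0// ltW.
  have -> : n = m.+1 by apply/eqP; rewrite eqn_leq nm ltn_neqAle mn eq_sym mneq.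
  apply: wL; apply: leq_trans n2.
  by rewrite ltn_neqAle mn eq_sym mneq.
have step l (s : R) : 0 <= s <= T -> `|w (fl l.+1 s) - w (fl l s)| <= L * a ^+ l.+1.
  move=> sT; have /andP[s0 _] := sT.
  have /andP[A1 A2] := idxP l s s0.
  have /andP[B1 B2] := idxP l.+1 s s0.
  have -> : fl l s = ((idx l s) * 2)%:R * g l.+1.
    by rewrite /fl gS natrM; ring.
  apply: adj; last exact: idxle.
    rewrite -ltnS -(ltr_nat R) -(ltr_pM2r (g0 l.+1)) natrM -mulrA -gS.
    exact: le_lt_trans B2.
  rewrite -ltnS -(ltr_nat R) -(ltr_pM2r (g0 l.+1)).
  apply: le_lt_trans B1 _; apply: lt_le_trans A2 _.
  by rewrite gS mulrA ler_pM2r// -natrM ler_nat mulSn addnC muln2 addn2.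
(* The right-hand side is the exact partial sum, which lets the induction close without loss. *)
have chain (j n : nat) (s : R) : 0 <= s <= T ->
    `|w (fl (j + n)%N s) - w (fl j s)| <= 4 * L * (a ^+ j - a ^+ (j + n)).
  move=> sT; elim: n => [|n IH].
    by rewrite addn0 !subrr normr0 mulr0.
  rewrite addnS -(subrK (w (fl (j + n)%N s)) (w _)) -addrA.
  rewrite (le_trans (ler_normD _ _))// (le_trans (lerD (step _ _ sT) IH))//.
  by rewrite exprS /a; lra.
have lim j (s : R) : 0 <= s <= T -> `|w s - w (fl j s)| <= 4 * L * a ^+ j.
  move=> sT; have /andP[s0 s1] := sT.
  apply/ler_addgt0Pr => e e0.
  have [d d0 H] := within_itvcc_eps cw sT e0.
  have [n nd] : exists n, g (j + n)%N < d.
    exists (Num.truncn (T / d)).+1.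
    rewrite /g ltr_pdivrMr ?exprn_gt0// mulrC -ltr_pdivrMr//.
    apply: lt_le_trans (truncnS_gt _) _.
    rewrite -natrX ler_nat ltnW//.
    apply: (@leq_trans (2 ^ (Num.truncn (T / d)).+1)); first exact: ltn_expl.
    by rewrite leq_exp2l// leq_addl.
  have /andP[A1 A2] := idxP (j + n)%N s s0.
  have flT : 0 <= fl (j + n)%N s <= T.
    by rewrite (le_trans A1)// mulr_ge0// ltW.
  have sd : `|s - fl (j + n)%N s| < d.
    rewrite ger0_norm ?subr_ge0//; apply: lt_trans nd.
    by rewrite -natr1 mulrDl mul1r -/(fl _ _) in A2; lra.
  have H1 := H _ flT sd; have H2 := chain j n s sT.
  rewrite -(subrK (w (fl (j + n)%N s)) (w s)) -addrA addrC.
  rewrite (le_trans (ler_normD _ _))// lerD// ?(ltW H1)//.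
  by rewrite (le_trans H2)// ler_wpM2l ?mulr_ge0// lerBlDr lerDl exprn_ge0// ltW.
move=> j s u sT uT su.
have /andP[s0 _] := sT; have /andP[u0 _] := uT.
have Hfl : `|w (fl j s) - w (fl j u)| <= L * a ^+ j.
  wlog : s u sT uT su s0 u0 / u <= s.
    move=> H; have [us|/ltW su'] := leP u s; first exact: H.
    by rewrite distrC; apply: H => //; rewrite distrC.
  move=> us; have /andP[A1 A2] := idxP j s s0; have /andP[B1 B2] := idxP j u u0.
  rewrite ger0_norm ?subr_ge0// -/(g j) in su.
  apply: adj; last exact: idxle.
    rewrite -ltnS -(ltr_nat R) -(ltr_pM2r (g0 j)).
    by rewrite (le_lt_trans B1)// (le_lt_trans us).
  rewrite -ltnS -(ltr_nat R) -(ltr_pM2r (g0 j)).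
  rewrite (le_lt_trans A1)// -(natr1 (idx j u).+1) mulrDl mul1r.
  have sg : s <= u + g j by lra.
  by rewrite (le_lt_trans sg)// ltrD2r.
have Hs := lim j s sT; have Hu := lim j u uT; rewrite distrC in Hu.
rewrite (_ : w s - w u = (w s - w (fl j s)) + (w (fl j s) - w (fl j u)) + (w (fl j u) - w u)); last by ring.
rewrite (le_trans (ler_normD _ _))//.
rewrite (_ : 9 * L * _ = 4 * L * a ^+ j + L * a ^+ j + 4 * L * a ^+ j); last by rewrite /a; ring.
by rewrite lerD// (le_trans (ler_normD _ _))// lerD.
Qed.
End chaining.

(** * The integral in the continuous version *)

Section integral_inv_sqrt.
Context {R : realType}.
Local Notation mu := (@lebesgue_measure R).

Lemma integral_inv_sqrt (alpha y a s : R) : 0 < alpha -> a <= s ->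
  \int[mu]_(u in `[a, s]) (alpha / Num.sqrt (y ^+ 2 + 2 * alpha * (u - a)))
  = Num.sqrt (y ^+ 2 + 2 * alpha * (s - a)) - `|y|.
Proof.
move=> al0; rewrite le_eqVlt => /predU1P[<-|as_].
  by rewrite set_itv1 Rintegral_set1 subrr mulr0 addr0 sqrtr_sqr subrr.
pose G (u : R) : R := Num.sqrt (y ^+ 2 + 2 * alpha * (u - a)).
pose g (u : R) : R := alpha / G u.
have cG : continuous G.
  move=> v; apply: continuous_comp; last exact: sqrt_continuous.
  apply: continuousD; first exact: cst_continuous.
  by apply: continuousM; [exact: cst_continuous|apply: continuousB => //; exact: cst_continuous].
have G0 u : a < u -> 0 < G u.
  by move=> au; rewrite sqrtr_gt0 ltr_wpDl ?sqr_ge0// !mulr_gt0// subr_gt0.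
have cg u : a < u -> {for u, continuous g}.
  move=> au; apply: cvgM; first exact: cvg_cst.
  by apply: cvgV; [rewrite gt_eqF// G0|exact: cG].
have dG u : a < u -> is_derive u 1 G (g u).
  move=> au; have A0 : 0 < y ^+ 2 + 2 * alpha * (u - a).
    by rewrite ltr_wpDl ?sqr_ge0// !mulr_gt0// subr_gt0.
  have dg : is_derive u 1 (fun u => y ^+ 2 + 2 * alpha * (u - a)) (2 * alpha).
    have duB : is_derive u 1 (fun u => u - a) 1.
      by apply: is_derive_eq; rewrite subr0.
    by apply: is_derive_eq; rewrite /GRing.scale /=; ring.
  have -> : g u = (2 * G u)^-1 * (2 * alpha).
    by rewrite /g; field; rewrite gt_eqF// G0.
  exact: (@is_derive1_comp _ Num.sqrt _ u _ _ (is_derive1_sqrt A0) dg).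
pose ai (i : nat) : R := a + (s - a) / i.+2%:R.
have aai i : a < ai i by rewrite ltrDl divr_gt0// subr_gt0.
have ais i : ai i < s.
  by rewrite -ltrBrDl ltr_pdivrMr// ltr_pMr ?subr_gt0// ltr1n.
pose F i := `[ai i, s]%classic : set R.
have intF i : (\int[mu]_(u in F i) (g u)%:E = (G s - G (ai i))%:E)%E.
  rewrite EFinB; apply: continuous_FTC2 => //.
  - apply: continuous_in_subspaceT => u; rewrite inE/= in_itv/= => /andP[u1 _].
    by apply: cg; rewrite (lt_le_trans (aai i)).
  - split.
    + move=> u; rewrite in_itv/= => /andP[u1 _].
      by have [] := dG u (lt_trans (aai i) u1).
    + exact/cvg_at_right_filter/cG.
    + exact/cvg_at_left_filter/cG.
  - move=> u; rewrite in_itv/= => /andP[u1 _].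
    by rewrite derive1E; have [_ ->] := dG u (lt_trans (aai i) u1).
have UF : \bigcup_i F i = `]a, s]%classic.
  apply/seteqP; split=> [u [i _]|u]; rewrite /F /= !in_itv/=.
    by move=> /andP[u1 ->]; rewrite (lt_le_trans (aai i)).
  move=> /andP[u1 us]; exists (Num.truncn ((s - a) / (u - a))) => //=.
  rewrite in_itv/= us andbT /ai -lerBrDl ler_pdivrMr// mulrC -ler_pdivrMr ?subr_gt0//.
  by rewrite (le_trans (ltW (truncnS_gt _)))// ler_nat.
have mg (D : set (measurableTypeR R)) : measurable D -> D `<=` `]a, s]%classic ->
    measurable_fun D (fun u => (g u)%:E).
  move=> mD DF; apply/measurable_EFinP.
  apply: subspace_continuous_measurable_fun => //.
  apply: continuous_in_subspaceT => u; rewrite inE => /DF /=.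
  by rewrite in_itv/= => /andP[u1 _]; exact: cg.
have cv : (\int[mu]_(u in F i) (g u)%:E)%E @[i --> \oo] -->
    (\int[mu]_(u in `]a, s]) (g u)%:E)%E.
  rewrite -UF; apply: ge0_nondecreasing_set_cvg_integral.
  - move=> m n mn; rewrite subsetEset; apply: subset_itvr; rewrite bnd_simp /ai.
    by rewrite lerD2l ler_pM2l ?subr_gt0// lef_pV2 ?posrE// ler_nat !ltnS.
  - by move=> i; exact: measurable_itv.
  - by move=> i; apply: mg; [exact: measurable_itv|rewrite -UF; exact: bigcup_sup].
  - move=> i u; rewrite /F /= in_itv/= => /andP[u1 _].
    by rewrite lee_fin divr_ge0 ?ltW// G0// (lt_le_trans (aai i)).
have cai : ai i @[i --> \oo] --> a.
  rewrite -[X in _ --> X]addr0 -[X in _ --> _ + X](mulr0 (s - a)).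
  apply: cvgD; first exact: cvg_cst.
  apply: cvgM; first exact: cvg_cst.
  by have := @cvg_harmonic R; rewrite -cvg_shiftS.
have cv2 : (\int[mu]_(u in F i) (g u)%:E)%E @[i --> \oo] --> (G s - G a)%:E.
  under eq_fun do rewrite intF.
  apply: cvg_EFin; first by near=> i.
  apply: cvgB; first exact: cvg_cst.
  exact: (cvg_comp _ _ cai (cG a)).
rewrite -/G -/g /Rintegral -integral_itv_obnd_cbnd; last by apply: mg => //; exact: measurable_itv.
have -> := cvg_unique _ cv cv2.
by rewrite /G subrr mulr0 addr0 sqrtr_sqr.
Unshelve. all: by end_near. Qed.
End integral_inv_sqrt.

(** * Densities and Gaussian moments *)

Section density.
Context d (T : measurableType d) (R : realType).
Variables (mu nu : {measure set T -> \bar R}) (g : T -> R).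
Hypotheses (mg : measurable_fun setT g) (g0 : forall x, 0 <= g x).
Hypothesis nuE : forall A, measurable A -> nu A = (\int[mu]_(x in A) (g x)%:E)%E.
Local Open Scope ereal_scope.
Import HBNNSimple.

Lemma ge0_integral_density (f : T -> \bar R) : measurable_fun setT f ->
  (forall x, 0 <= f x) -> \int[nu]_x f x = \int[mu]_x (f x * (g x)%:E).
Proof.
move=> mf f0.
have indic E : measurable E -> \int[nu]_x (\1_E x)%:E = \int[mu]_x ((\1_E x)%:E * (g x)%:E).
  move=> mE; rewrite integral_indic//= setIT nuE//.
  rewrite integral_mkcond; apply: eq_integral => x _; rewrite patchE indicE.
  by case: ifPn => xE; rewrite ?mul1e// mul0e.
have mgE : measurable_fun setT (fun x => (g x)%:E) by exact/measurable_EFinP.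
have gE0 x : 0 <= (g x)%:E by rewrite lee_fin.
have simple (h : {nnsfun T >-> R}) :
    \int[nu]_x (h x)%:E = \int[mu]_x ((h x)%:E * (g x)%:E).
  under [LHS]eq_integral do rewrite fimfunE -fsumEFin//.
  under [RHS]eq_integral.
    move=> x _; rewrite fimfunE -fsumEFin// ge0_mule_fsuml; last first.
      by move=> r; rewrite EFinM nnfun_muleindic_ge0.
    over.
  rewrite [LHS]ge0_integral_fsum//; last 2 first.
  - by move=> r; exact/measurable_EFinP/measurableT_comp.
  - by move=> r x _; rewrite EFinM nnfun_muleindic_ge0.
  rewrite [RHS]ge0_integral_fsum//; last 2 first.
  - by move=> r; apply: emeasurable_funM => //; exact/measurable_EFinP/measurableT_comp.
  - by move=> r x _; rewrite mule_ge0// EFinM nnfun_muleindic_ge0.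
  apply: eq_fsbigr => r _.
  have [r0|r0] := leP 0%R r; last first.
    rewrite preimage_nnfun0// !integral0_eq// => x _; rewrite indic0 mulr0//.
    by rewrite mul0e.
  under eq_integral do rewrite EFinM.
  under [RHS]eq_integral do rewrite EFinM -muleA.
  rewrite !ge0_integralZl//.
  - by rewrite indic.
  - by apply: emeasurable_funM => //; exact/measurable_EFinP.
  - by move=> x _; rewrite mule_ge0// lee_fin.
  - exact/measurable_EFinP.
pose h := nnsfun_approx measurableT mf.
transitivity (lim (\int[nu]_x (h n x)%:E @[n --> \oo])).
  rewrite -monotone_convergence//=.
  - apply: eq_integral => x _; apply/esym/cvg_lim => //.
    exact: cvg_nnsfun_approx.
  - by move=> n; exact/measurable_EFinP/measurable_funTS.
  - by move=> n x _; rewrite lee_fin.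
  - by move=> x _ m n mn; rewrite lee_fin; exact/lefP/nd_nnsfun_approx.
rewrite (_ : (fun n => _) = (fun n => \int[mu]_x ((h n x)%:E * (g x)%:E))); last first.
  by apply/funext => n; exact: simple.
rewrite -monotone_convergence//=.
- apply: eq_integral => x _.
  have cx : (h n x)%:E @[n --> \oo] --> f x by apply: cvg_nnsfun_approx.
  rewrite limeMr//; first by congr (_ * _); exact/cvg_lim.
  by apply/cvg_ex; exists (f x).
- by move=> n; apply: emeasurable_funM => //; exact/measurable_EFinP.
- by move=> n x _; rewrite mule_ge0// lee_fin.
- by move=> x _ m n mn; rewrite lee_wpmul2r// lee_fin; exact/lefP/nd_nnsfun_approx.
Qed.
End density.
Section normal_moments.
Context {R : realType}.
Local Notation mu := (@lebesgue_measure R).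
Implicit Types (f : R -> R) (s q : R).
Local Open Scope ereal_scope.

Lemma ge0_integral_symmetrize (G : R -> R) : (forall x, 0 <= G x)%R ->
  continuous G -> \int[mu]_x (G x)%:E = \int[mu]_x ((G x + G (- x)) / 2)%:E.
Proof.
move=> G0 cG.
have cGN : continuous (G \o -%R).
  by move=> x; apply: continuous_comp; [exact: opp_continuous|exact: cG].
have mG : measurable_fun [set: R] G by exact: continuous_measurable_fun.
have mGN : measurable_fun [set: R] (G \o -%R) by exact: continuous_measurable_fun.
rewrite [RHS]ge0_symfun_integralT; last 3 first.
- by move=> x; rewrite divr_ge0// addr_ge0.
- move=> x; apply: cvgM; last exact: cvg_cst.
  by apply: cvgD; [exact: cG|exact: cGN].
- by move=> x /=; rewrite opprK addrC.
rewrite -ge0_integralZl//=; last 3 first.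
- by rewrite -set_itvcy.
- by apply/measurable_EFinP/measurable_funTS; apply: measurable_funM => //; apply: measurable_funD.
- by move=> x _; rewrite lee_fin divr_ge0// addr_ge0.
under [RHS]eq_integral.
  move=> x _; rewrite -EFinM mulrC divfK// EFinD; over.
have mposnums : measurable [set x : R | 0 <= x]%R by rewrite -set_itvcy.
rewrite ge0_integralD//=; last 4 first.
- by move=> x _; rewrite lee_fin.
- exact/measurable_EFinP/measurable_funTS.
- by move=> x _; rewrite lee_fin.
- exact/measurable_EFinP/measurable_funTS.
rewrite -(setUv [set x : R | 0 <= x]%R) ge0_integral_setU//= ; last 4 first.
- exact: measurableC.
- by apply/measurable_EFinP; rewrite setUv.
- by move=> x _; rewrite lee_fin.
- exact/disj_setPCl.
congr (_ + _).
rewrite -set_itvcy// setCitvr.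
rewrite integral_itv_bndo_bndc; last exact/measurable_EFinP/measurable_funTS.
by rewrite -{1}oppr0 ge0_integration_by_substitutionNy//; exact: continuous_subspaceT.
Qed.

Lemma ge0_integral_normal_prob m s (f : R -> R) : (forall x, 0 <= f x)%R ->
  measurable_fun setT f ->
  \int[normal_prob m s]_x (f x)%:E = \int[mu]_x (f x * normal_pdf m s x)%:E.
Proof.
move=> f0 mf.
rewrite (@ge0_integral_density _ _ _ mu (normal_prob m s) (normal_pdf m s))//.
- exact: measurable_normal_pdf.
- exact: normal_pdf_ge0.
- exact/measurable_EFinP.
Qed.

(** This replaces the vanishing of odd moments by a statement about nonnegative functions, free of
    integrability conditions. *)
Lemma normal_prob_symmetrize s (f : R -> R) : s != 0%R -> (forall x, 0 <= f x)%R ->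
  continuous f ->
  \int[normal_prob 0 s]_x (f x)%:E =
  \int[normal_prob 0 s]_x ((f x + f (- x)) / 2)%:E.
Proof.
move=> s0 f0 cf.
have cfN : continuous (f \o -%R).
  by move=> x; apply: continuous_comp; [exact: opp_continuous|exact: cf].
have mf : measurable_fun [set: R] f by exact: continuous_measurable_fun.
have mfN : measurable_fun [set: R] (f \o -%R) by exact: continuous_measurable_fun.
rewrite !ge0_integral_normal_prob//; last 2 first.
- by move=> x; rewrite divr_ge0// addr_ge0.
- by apply: measurable_funM => //; apply: measurable_funD.
rewrite ge0_integral_symmetrize.
- apply: eq_integral => x _; congr EFin.
  rewrite (_ : normal_pdf 0 s (- x) = normal_pdf 0 s x); first by ring.
  by rewrite normal_pdfE// /normal_fun !subr0 sqrrN.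
- by move=> x; rewrite mulr_ge0// normal_pdf_ge0.
- by move=> x; apply: cvgM; [exact: cf|exact: continuous_normal_pdf].
Qed.

(** The integrand times the density of standard deviation [s] is [q] times the density of standard
    deviation [q * s]. The moment bounds below all come from this identity. *)
Lemma normal_prob_expR_sqr s q : (0 < s)%R -> (0 < q)%R ->
  \int[normal_prob 0 s]_x (expR ((1 - q ^- 2) * x ^+ 2 / (2 * s ^+ 2)))%:E = q%:E.
Proof.
move=> s0 q0.
have s0' : s != 0%R by rewrite gt_eqF.
have qs0 : (q * s != 0)%R by rewrite gt_eqF// mulr_gt0.
rewrite ge0_integral_normal_prob; last 2 first.
- by move=> x; exact: expR_ge0.
- apply: measurableT_comp => //; apply: measurable_funM => //.
  by apply: measurable_funM => //; apply: measurable_funX.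
under eq_integral => x _.
  rewrite (_ : (_ * _)%R = (q * normal_pdf 0 (q * s) x)%R); last first.
    rewrite !normal_pdfE// /normal_fun !subr0.
    rewrite mulrCA -expRD [RHS]mulrA; congr (_ * expR _)%R.
      rewrite /normal_peak.
      have -> : ((q * s) ^+ 2 * pi *+ 2 = q ^+ 2 * (s ^+ 2 * pi *+ 2) :> R)%R by ring.
      rewrite sqrtrM ?sqr_ge0//.
      rewrite sqrtr_sqr gtr0_norm// invfM mulrA divff ?mul1r//.
      by rewrite gt_eqF.
    rewrite exprMn; field.
    by rewrite s0' gt_eqF.
  over.
under eq_integral do rewrite EFinM.
rewrite ge0_integralZl//.
- by rewrite integral_normal_pdf mule1.
- by apply/measurable_EFinP; exact: measurable_normal_pdf.
- by move=> x _; rewrite lee_fin normal_pdf_ge0.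
- by rewrite lee_fin ltW.
Qed.

(** With [u = 3 / 4 * x ^ 2 / (2 * s ^ 2)], raise [u / k <= expR (u / k)] to the power [k]; [expR u]
    has mean 2 by the case [q = 2] of [normal_prob_expR_sqr]. *)
Lemma normal_prob_even_moment s k : (0 < s)%R -> (0 < k)%N ->
  \int[normal_prob 0 s]_x (x ^+ (2 * k))%:E <=
  (2 * (8 / 3 * k%:R) ^+ k * s ^+ (2 * k))%:E.
Proof.
move=> s0 k0.
have c0 : (0 <= (8 / 3 * k%:R) ^+ k * s ^+ (2 * k))%R.
  by rewrite mulr_ge0 ?exprn_ge0 ?mulr_ge0// ?ltW// divr_ge0.
have q34 : (3 / 4 = 1 - 2 ^- 2 :> R)%R by field.
have H x : (x ^+ (2 * k) <= (8 / 3 * k%:R) ^+ k * s ^+ (2 * k) *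
    expR (3 / 4 * x ^+ 2 / (2 * s ^+ 2)))%R.
  set u := (_ * x ^+ 2 / _)%R.
  have u0 : (0 <= u / k%:R)%R.
    by rewrite /u; do !(exact: sqr_ge0 || exact: ler0n || apply: divr_ge0 || apply: mulr_ge0).
  have -> : expR u = (expR (u / k%:R) ^+ k)%R.
    by rewrite -expRM_natr divfK// pnatr_eq0 -lt0n.
  rewrite !exprM -!exprMn; apply: lerXn2r; rewrite ?nnegrE ?sqr_ge0//.
    by do !(exact: sqr_ge0 || exact: ler0n || exact: expR_ge0 || apply: divr_ge0 || apply: mulr_ge0).
  have : (u / k%:R <= expR (u / k%:R))%R.
    by apply: le_trans (expR_ge1Dx _); rewrite lerDr.
  have -> : (x ^+ 2 = 8 / 3 * k%:R * s ^+ 2 * (u / k%:R))%R.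
    rewrite /u; field.
    by rewrite pnatr_eq0 -lt0n k0 gt_eqF.
  by move=> uk; apply: ler_wpM2l => //; do !(exact: sqr_ge0 || exact: ler0n || apply: divr_ge0 || apply: mulr_ge0).
have mE : measurable_fun setT (fun x : R => expR (3 / 4 * x ^+ 2 / (2 * s ^+ 2))).
  apply: measurableT_comp => //; apply: measurable_funM => //.
  by apply: measurable_funM => //; apply: measurable_funX.
apply: (@le_trans _ _ (\int[normal_prob 0 s]_x (((8 / 3 * k%:R) ^+ k * s ^+ (2 * k))%:E *
    (expR (3 / 4 * x ^+ 2 / (2 * s ^+ 2)))%:E))).
  apply: ge0_le_integral => //=.
  - by move=> x _; rewrite lee_fin exprM exprn_ge0// sqr_ge0.
  - by apply/measurable_EFinP; apply: measurable_funX.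
  - by apply: emeasurable_funM => //; apply/measurable_EFinP.
  - by move=> x _; rewrite -EFinM lee_fin; exact: H.
rewrite ge0_integralZl//.
- by rewrite q34 normal_prob_expR_sqr// -EFinM lee_fin; lra.
- exact/measurable_EFinP.
Qed.

Lemma normal_prob_variance_le s : (0 < s)%R ->
  \int[normal_prob 0 s]_x (x ^+ 2)%:E <= (s ^+ 2)%:E.
Proof.
move=> s0.
(* By [1 + u <= expR u] and the exponential moment, the variance is at most
   [s ^+ 2 * (2 * q ^+ 2 / (q + 1))] for every [1 < q]; then [q] tends to 1. *)
have H q : (1 < q)%R -> \int[normal_prob 0 s]_x (x ^+ 2)%:E <=
    (s ^+ 2 * (2 * q ^+ 2 / (q + 1)))%:E.
  move=> q1; have q0 : (0 < q)%R by rewrite (lt_trans _ q1).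
  pose c : R := ((1 - q ^- 2) / (2 * s ^+ 2))%R.
  have c0 : (0 < c)%R.
    by rewrite /c divr_gt0 ?mulr_gt0 ?exprn_gt0// subr_gt0 invf_lt1 ?exprn_gt0// exprn_egt1.
  have mE : measurable_fun setT (fun x : R => expR ((1 - q ^- 2) * x ^+ 2 / (2 * s ^+ 2))).
    apply: measurableT_comp => //; apply: measurable_funM => //.
    by apply: measurable_funM => //; apply: measurable_funX.
  have I : \int[normal_prob 0 s]_x (1 + c * x ^+ 2)%:E <= q%:E.
    rewrite -(normal_prob_expR_sqr s0 q0); apply: ge0_le_integral => //=.
    - by move=> x _; rewrite lee_fin addr_ge0// mulr_ge0 ?sqr_ge0// ltW.
    - apply/measurable_EFinP; apply: measurable_funD => //.
      by apply: measurable_funM => //; apply: measurable_funX.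
    - exact/measurable_EFinP.
    - move=> x _; rewrite lee_fin (le_trans (expR_ge1Dx _))// ler_expR /c.
      by rewrite mulrAC.
  have J : \int[normal_prob 0 s]_x (1 + c * x ^+ 2)%:E =
      1 + c%:E * \int[normal_prob 0 s]_x (x ^+ 2)%:E.
    under eq_integral do rewrite EFinD EFinM.
    rewrite ge0_integralD//=.
    - rewrite integral_cst//= probability_setT mul1e ge0_integralZl//=.
      + by apply/measurable_EFinP; apply: measurable_funX.
      + by move=> x _; rewrite lee_fin sqr_ge0.
      + by rewrite lee_fin ltW.
    - by move=> x _; rewrite mule_ge0// lee_fin ?sqr_ge0// ltW.
    - by apply: emeasurable_funM => //; apply/measurable_EFinP; apply: measurable_funX.
  have V0 : 0 <= \int[normal_prob 0 s]_x (x ^+ 2)%:E.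
    by apply: integral_ge0 => x _; rewrite lee_fin sqr_ge0.
  move: I; rewrite J; move: V0; case: (\int[_]_x _) => [v| |] //=.
    rewrite -EFinM -EFinD !lee_fin => v0 Hv.
    have cv : (v <= (q - 1) / c)%R by rewrite ler_pdivlMr// mulrC; lra.
    rewrite (le_trans cv)// /c le_eqVlt; apply/orP; left; apply/eqP; field.
    by rewrite !gt_eqF// ?subr_gt0// ?exprn_egt1// addr_gt0.
  by move=> _; rewrite gt0_muley ?lte_fin// addey//.
have V0 : 0 <= \int[normal_prob 0 s]_x (x ^+ 2)%:E.
  by apply: integral_ge0 => x _; rewrite lee_fin sqr_ge0.
move: V0 H; case: (\int[_]_x _) => [v| |] //=; last first.
  by move=> _ /(_ 2%R (ltr1n _ _)).
rewrite !lee_fin => v0 H; apply/ler_addgt0Pr => e e0.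
(* For [q = 1 + r] the factor exceeds 1 by at most [4 * r], and this [r] makes
   [4 * s ^ 2 * r <= e]. *)
pose r : R := (e / (4 * s ^+ 2 + e))%R.
have es0 : (0 < 4 * s ^+ 2 + e)%R by rewrite addr_gt0// mulr_gt0// exprn_gt0.
have r0 : (0 < r)%R by rewrite /r divr_gt0.
have r1 : (r <= 1)%R by rewrite /r ler_pdivrMr// mul1r lerDr mulr_ge0// sqr_ge0.
have q1 : (1 < 1 + r)%R by rewrite ltrDl.
have := H _ q1; rewrite lee_fin => /le_trans; apply.
have s20 : (0 < s ^+ 2)%R by rewrite exprn_gt0.
have rs : (4 * s ^+ 2 * r <= e)%R.
  by rewrite /r mulrA ler_pdivrMr// mulrC ler_pM2l// lerDl ltW.
have -> : (2 * (1 + r) ^+ 2 / (1 + r + 1) = 1 + (3 * r + 2 * r ^+ 2) / (2 + r) :> R)%R.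
  by field; rewrite gt_eqF// addr_gt0.
have : ((3 * r + 2 * r ^+ 2) / (2 + r) <= 4 * r)%R.
  rewrite ler_pdivrMr; last by rewrite addr_gt0.
  have : (0 <= r ^+ 2)%R by exact: sqr_ge0.
  lra.
move=> /(ler_wpM2l (ltW s20)); lra.
Qed.
End normal_moments.

(** * One step of the scheme in expectation *)

Section independence.
Context d (Omega : measurableType d) (R : realType) (P : probability Omega R).
Context d1 (T1 : measurableType d1) d2 (T2 : measurableType d2).
Local Open Scope ereal_scope.

(** Takes the place of conditioning on [X]: the law of the pair agrees with the product measure on
    rectangles, hence everywhere, and Tonelli's theorem integrates [V] out first. *)
Lemma ge0_integral_indep (X : Omega -> T1) (V : Omega -> T2)
    (nu : probability T2 R) (phi : T1 * T2 -> \bar R) :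
  measurable_fun setT X -> measurable_fun setT V ->
  (forall A B, measurable A -> measurable B ->
    P (X @^-1` A `&` V @^-1` B) = P (X @^-1` A) * nu B) ->
  measurable_fun setT phi -> (forall z, 0 <= phi z) ->
  \int[P]_w phi (X w, V w) = \int[P]_w \int[nu]_v phi (X w, v).
Proof.
move=> mX mV XV mphi phi0.
pose X' : {mfun Omega >-> T1} := HB.pack X (isMeasurableFun.Build _ _ _ _ _ mX).
have mXV : measurable_fun setT (fun w => (X w, V w)).
  by apply: measurable_fun_pair.
pose XV' : {mfun Omega >-> (T1 * T2)%type} := HB.pack (fun w => (X w, V w)) (isMeasurableFun.Build _ _ _ _ _ mXV).
rewrite -(@ge0_integral_pushforward _ _ _ _ _ _ mXV P setT phi)//.
rewrite (@eq_measure_integral _ _ _ _ (distribution P X' \x nu)%E)//; last first.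
  move=> A mA _.
  by apply/esym/(@product_measure_unique _ _ _ _ _ (distribution P X') nu (distribution P XV')).
rewrite fubini_tonelli1//.
rewrite ge0_integral_pushforward//.
  exact: measurable_fun_fubini_tonelli_F.
by move=> x _; exact: integral_ge0.
Qed.
End independence.
Section one_step.
Context {R : realType}.
Implicit Types (alpha beta gamma h e y z w : R).

(* Averaging over the sign of the Gaussian increment [w] removes the odd terms; the
   remainder is relative to [1 / (z ^ 2 + e)], so that it only costs a factor
   [expR (C h)] in one step. *)
Lemma symmetrized_inv_le e z w : 0 < e ->
  (((z + w) ^+ 2 + e)^-1 + ((z - w) ^+ 2 + e)^-1) / 2 <=
  (z ^+ 2 + e)^-1 + 3 * w ^+ 2 * (z ^+ 2 + e) ^- 2
  + 5 * w ^+ 4 * ((z ^+ 2 + e)^-1 * e ^- 2).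
Proof.
move=> e0.
set a := z ^+ 2 + e.
have a0 : 0 < a by rewrite /a ltr_wpDl ?sqr_ge0.
have u0 : 0 < (z + w) ^+ 2 + e by rewrite ltr_wpDl ?sqr_ge0.
have v0 : 0 < (z - w) ^+ 2 + e by rewrite ltr_wpDl ?sqr_ge0.
set u := (z + w) ^+ 2 + e in u0 *; set v := (z - w) ^+ 2 + e in v0 *.
have ue : e <= u by rewrite /u lerDr sqr_ge0.
have ve : e <= v by rewrite /v lerDr sqr_ge0.
have D0 : 0 < u * v by rewrite mulr_gt0.
have De : e ^+ 2 <= u * v by rewrite expr2 ler_pM// ltW.
have -> : (u^-1 + v^-1) / 2 = (a + w ^+ 2) / (u * v).
  rewrite (_ : a + w ^+ 2 = (u + v) / 2); last by rewrite /a /u /v; field.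
  by field; rewrite !gt_eqF.
(* The claim with denominators cleared, except that the last term lacks the factor [u * v / e ^ 2],
   which is at least 1. *)
have key : (a + w ^+ 2) * a ^+ 2 <= (a + 3 * w ^+ 2) * (u * v) + 5 * a * w ^+ 4.
  have w2 : 0 <= w ^+ 2 := sqr_ge0 w.
  have h1 : 0 <= w ^+ 2 * (3 * (w ^+ 2) ^+ 2 + 4 * e * a + 12 * e * w ^+ 2).
    by nonneg.
  rewrite -subr_ge0.
  rewrite (_ : _ - _ = w ^+ 2 * (3 * (w ^+ 2) ^+ 2 + 4 * e * a + 12 * e * w ^+ 2))//.
  by rewrite /u /v /a; ring.
rewrite ler_pdivrMr//.
have a2 : 0 < a ^+ 2 by rewrite exprn_gt0.
rewrite -(ler_pM2r a2) (le_trans key)//.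
have -> : (a^-1 + 3 * w ^+ 2 / a ^+ 2 + 5 * w ^+ 4 * (a^-1 / e ^+ 2)) * (u * v) * a ^+ 2 =
  (a + 3 * w ^+ 2) * (u * v) + 5 * a * w ^+ 4 * (u * v / e ^+ 2).
  by field; rewrite !gt_eqF.
rewrite lerD2l ler_peMr//; last by rewrite ler_pdivlMr ?exprn_gt0// mul1r.
by nonneg.
Qed.

(** The square root raises [y ^ 2] by exactly [2 * alpha * h], which lowers the reciprocal by at
    least [2 * alpha * h * a ^- 2]; the noise gives back at most [3 * gamma ^ 2 * h * a ^- 2].
    Discounting costs the factor [b], and [h <= T * e ^ 2] turns the fourth-order remainder into a
    relative error of order [h]. *)
Lemma one_step_le alpha beta gamma h e T y :
  0 < alpha -> 0 < beta -> 3 * gamma ^+ 2 <= 2 * alpha -> 0 < h -> 0 < e ->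
  h <= T * e ^+ 2 ->
  (\int[normal_prob 0 (Num.sqrt h)]_x
     (((expR (- beta * h) * (Num.sqrt (y ^+ 2 + 2 * alpha * h) + gamma * x)) ^+ 2
       + e)^-1)%:E
   + ((2 * alpha - 3 * gamma ^+ 2) * h * (y ^+ 2 + e + 2 * alpha * h) ^- 2)%:E
  <= (expR ((2 * beta + 300 * gamma ^+ 4 * T) * h) * (y ^+ 2 + e)^-1)%:E)%E.
Proof.
move=> alpha0 beta0 ag h0 e0 hT.
have sh0 : 0 < Num.sqrt h by rewrite sqrtr_gt0.
set z := Num.sqrt (y ^+ 2 + 2 * alpha * h).
have z2 : z ^+ 2 = y ^+ 2 + 2 * alpha * h.
  by rewrite sqr_sqrtr// addr_ge0 ?sqr_ge0// !mulr_ge0// ltW.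
pose a := z ^+ 2 + e.
have a0 : 0 < a by rewrite /a ltr_wpDl ?sqr_ge0.
pose b : R := expR (2 * beta * h).
have b0 : 0 < b by exact: expR_gt0.
pose f x := ((z + gamma * x) ^+ 2 + e)^-1.
have fd x : 0 < (z + gamma * x) ^+ 2 + e by rewrite ltr_wpDl ?sqr_ge0.
have f0 x : 0 <= f x by rewrite /f invr_ge0 ltW.
have cf : continuous f.
  move=> x; apply: cvgV; first by rewrite gt_eqF.
  apply: cvgD; last exact: cvg_cst.
  apply: (cvg_comp _ (fun x : R => x ^+ 2)); last exact: sqr_continuous.
  apply: cvgD; first exact: cvg_cst.
  by apply: cvgM; [exact: cvg_cst|exact: cvg_id].
have mf : measurable_fun [set: R] f by exact: continuous_measurable_fun.
have step1 x : ((expR (- beta * h) * (z + gamma * x)) ^+ 2 + e)^-1 <= b * f x.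
  rewrite /f -[b]invrK -invfM lef_pV2 ?posrE.
  - rewrite /b -expRN exprMn -expRM_natl mulrDr.
    have -> : 2 * (- beta * h) = - (2 * beta * h) :> R by ring.
    rewrite lerD2l ler_piMl ?(ltW e0)//.
    by rewrite -[leRHS]expR0 ler_expR oppr_le0 !mulr_ge0// ltW.
  - by rewrite ltr_wpDl ?sqr_ge0.
  - by rewrite mulr_gt0 ?invr_gt0.
have mf1 : measurable_fun [set: R]
    (fun x => ((expR (- beta * h) * (z + gamma * x)) ^+ 2 + e)^-1).
  apply: continuous_measurable_fun => x; apply: cvgV.
    by rewrite gt_eqF// ltr_wpDl ?sqr_ge0.
  apply: cvgD; last exact: cvg_cst.
  apply: (cvg_comp _ (fun x : R => x ^+ 2)); last exact: sqr_continuous.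
  apply: cvgM; first exact: cvg_cst.
  apply: cvgD; first exact: cvg_cst.
  by apply: cvgM; [exact: cvg_cst|exact: cvg_id].
have I1 : (\int[normal_prob 0 (Num.sqrt h)]_x
     (((expR (- beta * h) * (z + gamma * x)) ^+ 2 + e)^-1)%:E <=
    b%:E * \int[normal_prob 0 (Num.sqrt h)]_x (f x)%:E)%E.
  rewrite -ge0_integralZl//=.
  - apply: ge0_le_integral => //=.
    + by move=> x _; rewrite lee_fin invr_ge0 addr_ge0 ?sqr_ge0// ltW.
    + exact/measurable_EFinP.
    + by apply: emeasurable_funM => //; exact/measurable_EFinP.
    + by move=> x _; rewrite -EFinM lee_fin; exact: step1.
  - exact/measurable_EFinP.
  - by move=> x _; rewrite lee_fin.
  - by rewrite lee_fin ltW.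
have I2 : (\int[normal_prob 0 (Num.sqrt h)]_x (f x)%:E <=
   (a^-1 + 3 * gamma ^+ 2 * a ^- 2 * h + 300 * gamma ^+ 4 * (a^-1 * e ^- 2) * h ^+ 2)%:E)%E.
  rewrite normal_prob_symmetrize ?gt_eqF//.
  pose c2 := 3 * gamma ^+ 2 * a ^- 2; pose c4 := 5 * gamma ^+ 4 * (a^-1 * e ^- 2).
  have c20 : 0 <= c2 by rewrite /c2; nonneg.
  have c40 : 0 <= c4.
    by rewrite /c4; nonneg.
  have mp n : measurable_fun [set: R] (fun x : R => (x ^+ n)%:E).
    by apply/measurable_EFinP; apply: measurable_funX.
  apply: (@le_trans _ _ (\int[normal_prob 0 (Num.sqrt h)]_x
     ((a^-1)%:E + (c2%:E * (x ^+ 2)%:E + c4%:E * (x ^+ (2 * 2))%:E)))%E).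
    apply: ge0_le_integral => //=.
    - by move=> x _; rewrite lee_fin divr_ge0// addr_ge0.
    - apply/measurable_EFinP; apply: measurable_funM => //.
      apply: measurable_funD => //; apply: (measurableT_comp mf).
      by apply: continuous_measurable_fun; exact: opp_continuous.
    - apply: emeasurable_funD => //.
      by apply: emeasurable_funD; apply: emeasurable_funM => //; exact: mp.
    - move=> x _; rewrite -!EFinM -!EFinD lee_fin /f.
      have := symmetrized_inv_le z (gamma * x) e0.
      rewrite mulrN => /le_trans; apply.
      rewrite -/a le_eqVlt; apply/orP; left; apply/eqP.
      by rewrite /c2 /c4 /=; ring.
  rewrite ge0_integralD//=; last 3 first.
  - by move=> x _; rewrite lee_fin invr_ge0 ltW.
  - by move=> x _; rewrite -!EFinM -EFinD lee_fin addr_ge0// mulr_ge0 ?exprn_even_ge0.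
  - by apply: emeasurable_funD; apply: emeasurable_funM => //; exact: mp.
  rewrite integral_cst//= probability_setT mule1.
  rewrite ge0_integralD//=; last 4 first.
  - by move=> x _; rewrite -EFinM lee_fin mulr_ge0 ?sqr_ge0.
  - by apply: emeasurable_funM => //; exact: mp.
  - by move=> x _; rewrite -EFinM lee_fin mulr_ge0 ?exprn_even_ge0.
  - by apply: emeasurable_funM => //; exact: mp.
  have Zl (c : R) n : 0 <= c -> (\int[normal_prob 0 (Num.sqrt h)]_x (c%:E * (x ^+ (2 * n))%:E) =
      c%:E * \int[normal_prob 0 (Num.sqrt h)]_x (x ^+ (2 * n))%:E)%E.
    move=> c0; rewrite ge0_integralZl//; first exact: mp.
    by move=> x _; rewrite lee_fin exprM; nonneg.
  rewrite (Zl _ 1%N)// (Zl _ 2%N)//.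
  rewrite -addrA !EFinD; apply: leeD => //; apply: leeD.
    rewrite [leRHS]EFinM; apply: lee_wpmul2l; first by rewrite lee_fin.
    by rewrite -[X in (_ <= X%:E)%E](sqr_sqrtr (ltW h0)); exact: normal_prob_variance_le.
  (* The second moment competes with [2 * alpha], so its constant had to be exactly 1. The fourth
     moment may be crude: [5 * 2 * (16 / 3) ^ 2 <= 300]. *)
  have := @normal_prob_even_moment R (Num.sqrt h) 2 sh0 isT.
  rewrite [in leRHS]exprM sqr_sqrtr ?(ltW h0)// => /(lee_wpmul2l _) H.
  apply: le_trans (H c4%:E _) _; first by rewrite lee_fin.
  rewrite -EFinM lee_fin /c4.
  have : 0 <= gamma ^+ 4 * (a^-1 * e ^- 2) * h ^+ 2.
    by nonneg.
  lra.
rewrite -/z.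
set C := 300 * gamma ^+ 4 * T.
have hC : 300 * gamma ^+ 4 * (a^-1 * e ^- 2) * h ^+ 2 <= C * h * a^-1.
  have e20 : 0 < e ^+ 2 by rewrite exprn_gt0.
  have he : h * e ^- 2 <= T by rewrite ler_pdivrMr.
  have c0 : 0 <= 300 * gamma ^+ 4 * a^-1 * h.
    by nonneg.
  have := ler_wpM2l c0 he; rewrite /C; lra.
have C0 : 0 <= C * h.
  have T0 : 0 <= T by rewrite -(pmulr_lge0 _ (exprn_gt0 2 e0)) (le_trans (ltW h0)).
  by rewrite /C; nonneg.
(* The gain is measured at [a], after the drift step, where the noise term is also evaluated; hence
   the shift [2 * alpha * h] in the denominators of [level_sum]. *)
have iv : (y ^+ 2 + e)^-1 >= a^-1 + 2 * alpha * h * a ^- 2.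
  set v := y ^+ 2 + e.
  have v0 : 0 < v by rewrite /v ltr_wpDl ?sqr_ge0.
  have av : a = v + 2 * alpha * h by rewrite /a z2 /v; ring.
  have k0 : 0 <= 2 * alpha * h by rewrite !mulr_ge0// ltW.
  rewrite -subr_ge0 (_ : _ - _ = (2 * alpha * h) ^+ 2 / (v * a ^+ 2)).
    by rewrite divr_ge0 ?sqr_ge0// mulr_ge0 ?sqr_ge0 ?ltW.
  have va0 : v + 2 * alpha * h != 0 by rewrite -av gt_eqF.
  by rewrite av; field; rewrite va0 gt_eqF.
have final : b * (a^-1 + 3 * gamma ^+ 2 * a ^- 2 * h
      + 300 * gamma ^+ 4 * (a^-1 * e ^- 2) * h ^+ 2) +
   (2 * alpha - 3 * gamma ^+ 2) * h * (y ^+ 2 + e + 2 * alpha * h) ^- 2 <=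
   expR ((2 * beta + C) * h) * (y ^+ 2 + e)^-1.
  have -> : y ^+ 2 + e + 2 * alpha * h = a by rewrite /a z2; ring.
  have -> : expR ((2 * beta + C) * h) = b * expR (C * h).
    by rewrite /b -expRD; congr expR; ring.
  have E1 : 1 + C * h <= expR (C * h) by exact: expR_ge1Dx.
  have b1 : 1 <= b by rewrite /b -expR0 ler_expR !mulr_ge0// ltW.
  set G := (2 * alpha - 3 * gamma ^+ 2) * h * a ^- 2.
  have G0 : 0 <= G.
    have ag0 : 0 <= 2 * alpha - 3 * gamma ^+ 2 by rewrite subr_ge0.
    by rewrite /G; nonneg.
  have g0 : 0 <= 3 * gamma ^+ 2 * a ^- 2 * h.
    by nonneg.
  have K1 : a^-1 + 3 * gamma ^+ 2 * a ^- 2 * h + 300 * gamma ^+ 4 * (a^-1 * e ^- 2) * h ^+ 2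
      <= expR (C * h) * (a^-1 + 3 * gamma ^+ 2 * a ^- 2 * h).
    have : (1 + C * h) * (a^-1 + 3 * gamma ^+ 2 * a ^- 2 * h) <= expR (C * h) * (a^-1 + 3 * gamma ^+ 2 * a ^- 2 * h).
      by rewrite ler_wpM2r// addr_ge0// invr_ge0 ltW.
    apply: le_trans.
    have := mulr_ge0 C0 g0; lra.
  have K2 : G <= b * expR (C * h) * G.
    by rewrite ler_peMl// mulr_ege1// (le_trans _ E1)// lerDl.
  apply: (@le_trans _ _ (b * expR (C * h) * (a^-1 + 3 * gamma ^+ 2 * a ^- 2 * h) + b * expR (C * h) * G)).
    by apply: lerD => //; rewrite -[leRHS]mulrA ler_pM2l.
  rewrite -mulrDr ler_pM2l ?mulr_gt0 ?expR_gt0//.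
  by apply: le_trans iv; rewrite /G; lra.
apply: (@le_trans _ _ ((b * (a^-1 + 3 * gamma ^+ 2 * a ^- 2 * h
      + 300 * gamma ^+ 4 * (a^-1 * e ^- 2) * h ^+ 2))%:E +
   ((2 * alpha - 3 * gamma ^+ 2) * h * (y ^+ 2 + e + 2 * alpha * h) ^- 2)%:E)%E).
  apply: leeD => //; apply: le_trans I1 _.
  by rewrite EFinM; apply: lee_wpmul2l => //; rewrite lee_fin ltW.
by rewrite -EFinD lee_fin.
Qed.
End one_step.
Section wiener_scheme.
Context (R : realType) d (Omega : measurableType d) (P : probability Omega R).
Variables (W : R -> Omega -> R).
Hypothesis wW : wiener_process P W.
Implicit Types (s t h : R).

(** With these generators the natural filtration becomes a measurable type, and adaptedness follows
    from the usual closure properties of measurable functions. *)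
Let gen t : set (set Omega) := [set A | exists s : R, exists B : set R,
  [/\ 0 <= s <= t, measurable B & A = W s @^-1` B]].

Lemma natural_filtration_measurable_fun t (X : Omega -> R) :
  @measurable_fun _ _ (g_sigma_algebraType (gen t)) R setT X ->
  measurable_wrt (natural_filtration W t) X.
Proof. by move=> mX B mB; have := mX measurableT B mB; rewrite setTI. Qed.

Lemma measurable_fun_wiener_gen t s : 0 <= s <= t ->
  @measurable_fun _ _ (g_sigma_algebraType (gen t)) R setT (W s).
Proof.
move=> st _ B mB; rewrite setTI; apply: sub_sigma_algebra.
by exists s, B.
Qed.

Lemma natural_filtration_sub t A : natural_filtration W t A -> measurable A.
Proof.
have [mW _ _ _ _] := wW.
move=> H; apply: H => //; split.
  exact: sigma_algebra_measurable.
move=> _ [s [B [/andP[s0 _] mB ->]]].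
by rewrite -[X in measurable X]setTI; exact: mW.
Qed.

Variables (alpha beta gamma Y0 : R).
Local Notation S h k w := (unif_scheme alpha beta gamma Y0 h (fun s => W s w) k).

Lemma measurable_fun_unif_scheme_gen h k t : 0 <= h -> k%:R * h <= t ->
  @measurable_fun _ _ (g_sigma_algebraType (gen t)) R setT (fun w => S h k w).
Proof.
move=> h0; elim: k => [|k IH] kt /=; first exact: measurable_cst.
have kt' : k%:R * h <= t by rewrite (le_trans _ kt)// ler_wpM2r// ler_nat.
have msqrt : measurable_fun [set: R] (@Num.sqrt R).
  by apply: continuous_measurable_fun; exact: sqrt_continuous.
apply: measurable_funM => //; apply: measurable_funD.
  apply: (measurableT_comp msqrt); apply: measurable_funD => //.
  by apply: measurable_funX; exact: IH.
apply: measurable_funM => //; apply: measurable_funB.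
  by apply: measurable_fun_wiener_gen; rewrite kt andbT mulr_ge0.
by apply: measurable_fun_wiener_gen; rewrite kt' andbT mulr_ge0.
Qed.

Lemma measurable_fun_unif_scheme h k : 0 <= h ->
  measurable_fun setT (fun w => S h k w).
Proof.
move=> h0 _ B mB; rewrite setTI; apply: (@natural_filtration_sub (k%:R * h)).
by apply: natural_filtration_measurable_fun mB; exact: measurable_fun_unif_scheme_gen.
Qed.

Let inv_sqr_continuous e : 0 < e -> continuous (fun y : R => (y ^+ 2 + e)^-1).
Proof.
move=> e0 y; apply: cvgV; first by rewrite gt_eqF// ltr_wpDl ?sqr_ge0.
by apply: cvgD; [exact: sqr_continuous|exact: cvg_cst].
Qed.

Lemma unif_scheme_step_le h e T k :
  0 < alpha -> 0 < beta -> 3 * gamma ^+ 2 <= 2 * alpha -> 0 < h -> 0 < e ->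
  h <= T * e ^+ 2 ->
  (\int[P]_w (((S h k.+1 w) ^+ 2 + e)^-1)%:E
   + \int[P]_w ((2 * alpha - 3 * gamma ^+ 2) * h
        * ((S h k w) ^+ 2 + e + 2 * alpha * h) ^- 2)%:E
   <= (expR ((2 * beta + 300 * gamma ^+ 4 * T) * h))%:E
      * \int[P]_w (((S h k w) ^+ 2 + e)^-1)%:E)%E.
Proof.
move=> alpha0 beta0 ag h0 e0 hT.
have [mW _ _ nW iW] := wW.
have kh0 : 0 <= k%:R * h by rewrite mulr_ge0// ltW.
have kh1 : k%:R * h < k.+1%:R * h by rewrite ltr_pM2r// ltr_nat.
have mS := @measurable_fun_unif_scheme h k (ltW h0).
have mV : measurable_fun setT (fun w => W (k.+1%:R * h) w - W (k%:R * h) w).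
  by apply: measurable_funB; apply: mW => //; rewrite (le_trans kh0)// ltW.
have hE : k.+1%:R * h - k%:R * h = h by rewrite -mulrBl -natrB// subSnn mul1r.
have XV0 A B : measurable A -> measurable B ->
    P ((fun w => S h k w) @^-1` A `&` (fun w => W (k.+1%:R * h) w - W (k%:R * h) w) @^-1` B)
    = (P ((fun w => S h k w) @^-1` A) * normal_prob 0 (Num.sqrt h) B)%E.
  move=> mA mB.
  have nfA : natural_filtration W (k%:R * h) ((fun w => S h k w) @^-1` A).
    apply: natural_filtration_measurable_fun mA.
    exact: measurable_fun_unif_scheme_gen (ltW h0) (lexx _).
  have E1 := iW _ _ kh0 kh1 _ nfA B mB.
  have E2 := nW _ _ kh0 kh1 B mB.
  by rewrite hE in E2; rewrite -E2 E1.
pose f (y : R) : R := (y ^+ 2 + e)^-1.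
have f0 y : 0 <= f y by rewrite /f; nonneg.
have mf : measurable_fun [set: R] f.
  by apply: continuous_measurable_fun; exact: inv_sqr_continuous.
pose psi (z : R * R) : R := expR (- beta * h) *
  (Num.sqrt (z.1 ^+ 2 + 2 * alpha * h) + gamma * z.2).
have msqrt : measurable_fun [set: R] (@Num.sqrt R).
  by apply: continuous_measurable_fun; exact: sqrt_continuous.
have mpsi : measurable_fun setT psi.
  apply: measurable_funM => //; apply: measurable_funD.
    apply: (measurableT_comp msqrt); apply: measurable_funD => //.
    exact: measurable_funX.
  exact: measurable_funM.
have mfpsi : measurable_fun setT (fun z => (f (psi z))%:E).
  by apply/measurable_EFinP; exact: (measurableT_comp mf).
have fpsi0 z : (0 <= (f (psi z))%:E)%E by rewrite lee_fin.
have mF := @measurable_fun_fubini_tonelli_F _ _ _ _ R (normal_prob 0 (Num.sqrt h)) _ mfpsi fpsi0.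
have E := @ge0_integral_indep _ _ R P _ R _ (measurableTypeR R) _ _ (normal_prob 0 (Num.sqrt h)) _ mS mV XV0 mfpsi fpsi0.
rewrite [X in (X + _ <= _)%E](_ : _ = (\int[P]_w (f (psi (S h k w, W (k.+1%:R * h) w - W (k%:R * h) w)))%:E)%E)//.
rewrite E.
have mI : measurable_fun setT
    (fun w => \int[normal_prob 0 (Num.sqrt h)]_v (f (psi (S h k w, v)))%:E)%E.
  exact: (measurableT_comp mF mS).
pose g y : R := (2 * alpha - 3 * gamma ^+ 2) * h * (y ^+ 2 + e + 2 * alpha * h) ^- 2.
have g0 y : 0 <= g y.
  have ag0 : 0 <= 2 * alpha - 3 * gamma ^+ 2 by rewrite subr_ge0.
  by rewrite /g; nonneg.
have mg : measurable_fun [set: R] g.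
  apply: measurable_funM => //.
  have ge0 : 0 < e + 2 * alpha * h by rewrite addr_gt0// !mulr_gt0.
  have -> : (fun y : R => (y ^+ 2 + e + 2 * alpha * h) ^- 2) =
      (fun y => ((y ^+ 2 + (e + 2 * alpha * h))^-1) ^+ 2).
    by apply/funext => y; rewrite addrA exprVn.
  apply: measurable_funX; apply: continuous_measurable_fun.
  exact: inv_sqr_continuous.
have mfS : measurable_fun setT (fun w => (f (S h k w))%:E).
  by apply/measurable_EFinP; exact: (measurableT_comp mf mS).
have mgS : measurable_fun setT (fun w => (g (S h k w))%:E).
  by apply/measurable_EFinP; exact: (measurableT_comp mg mS).
pose C := expR ((2 * beta + 300 * gamma ^+ 4 * T) * h).
have ZE : (C%:E * \int[P]_w (f (S h k w))%:E = \int[P]_w (C%:E * (f (S h k w))%:E))%E.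
  rewrite ge0_integralZl//; last by rewrite lee_fin expR_ge0.
  by move=> w _; rewrite lee_fin; exact: f0.
have DE : (\int[P]_w (\int[normal_prob 0 (Num.sqrt h)]_v (f (psi (S h k w, v)))%:E
      + (g (S h k w))%:E) =
   \int[P]_w \int[normal_prob 0 (Num.sqrt h)]_v (f (psi (S h k w, v)))%:E
   + \int[P]_w (g (S h k w))%:E)%E.
  rewrite ge0_integralD//.
  - by move=> w _; apply: integral_ge0 => v _; exact: fpsi0.
  - by move=> w _; rewrite lee_fin; exact: g0.
rewrite -/C -[leRHS]/(C%:E * \int[P]_w (f (S h k w))%:E)%E ZE.
rewrite -[leLHS]DE.
apply: ge0_le_integral => //=.
- move=> w _; apply: adde_ge0; last by rewrite lee_fin; exact: g0.
  by apply: integral_ge0 => v _; exact: fpsi0.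
- exact: emeasurable_funD.
- exact: emeasurable_funM.
- by move=> w _; rewrite -EFinM; exact: one_step_le.
Qed.

(** A discrete Gronwall argument: the one-step factor is at least 1, so multiplying the sum already
    collected by it only weakens the bound. *)
Lemma unif_scheme_sum_le h e T m :
  0 < alpha -> 0 < beta -> 3 * gamma ^+ 2 <= 2 * alpha -> 0 < h -> 0 < e ->
  h <= T * e ^+ 2 ->
  (\int[P]_w (((S h m w) ^+ 2 + e)^-1)%:E
   + \sum_(0 <= k < m) \int[P]_w ((2 * alpha - 3 * gamma ^+ 2) * h
        * ((S h k w) ^+ 2 + e + 2 * alpha * h) ^- 2)%:E
   <= (expR ((2 * beta + 300 * gamma ^+ 4 * T) * h) ^+ m * (Y0 ^+ 2 + e)^-1)%:E)%E.
Proof.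
move=> alpha0 beta0 ag h0 e0 hT.
have T0 : 0 <= T by rewrite -(pmulr_lge0 _ (exprn_gt0 2 e0)) (le_trans (ltW h0)).
elim: m => [|m IH].
  rewrite big_geq// adde0 expr0 mul1r /=.
  by rewrite integral_cst//= probability_setT mule1 lexx.
rewrite big_nat_recr// [X in (_ + X <= _)%E]addeC addeA.
have g0 k : (0 <= \int[P]_w ((2 * alpha - 3 * gamma ^+ 2) * h
    * ((S h k w) ^+ 2 + e + 2 * alpha * h) ^- 2)%:E)%E.
  apply: integral_ge0 => w _; rewrite lee_fin.
  have ag0 : 0 <= 2 * alpha - 3 * gamma ^+ 2 by rewrite subr_ge0.
  by nonneg.
set E := expR ((2 * beta + _) * h).
have E1 : 1 <= E.
  by rewrite /E -[leLHS]expR0 ler_expR; nonneg.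
apply: (@le_trans _ _ (E%:E * (\int[P]_w (((S h m w) ^+ 2 + e)^-1)%:E
   + \sum_(0 <= k < m) \int[P]_w ((2 * alpha - 3 * gamma ^+ 2) * h
        * ((S h k w) ^+ 2 + e + 2 * alpha * h) ^- 2)%:E))%E).
  rewrite ge0_muleDr; last 2 first.
  - by apply: integral_ge0 => w _; rewrite lee_fin; nonneg.
  - exact: sume_ge0.
  apply: leeD; first exact: unif_scheme_step_le.
  by rewrite lee_pemull ?sume_ge0// lee_fin.
have -> : (E ^+ m.+1 * (Y0 ^+ 2 + e)^-1)%:E = (E%:E * (E ^+ m * (Y0 ^+ 2 + e)^-1)%:E)%E.
  by rewrite -EFinM mulrA -exprS.
by apply: lee_wpmul2l => //; rewrite lee_fin (le_trans _ E1).
Qed.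

(** There are [T / h] steps, so the compounded factor depends on [T] alone and the bound is uniform
    in [j]. *)
Lemma expectation_level_sum_le T j :
  0 < alpha -> 0 < beta -> 3 * gamma ^+ 2 < 2 * alpha -> 0 < T -> 0 < Y0 ->
  (\int[P]_w (level_sum alpha beta gamma Y0 T (fun s => W s w) j)%:E <=
   (expR ((2 * beta + 300 * gamma ^+ 4 * T) * T)
     / ((2 * alpha - 3 * gamma ^+ 2) * Y0 ^+ 2))%:E)%E.
Proof.
move=> alpha0 beta0 ag T0 Y00.
set h := level_mesh T j.
have h0 : 0 < h by rewrite divr_gt0// exprn_gt0.
pose e : R := (4 / 5) ^+ (2 * j).
have e0 : 0 < e by rewrite exprn_gt0.
have hT : h <= T * e ^+ 2.
  rewrite /h /level_mesh ler_pM2l// /e -exprM (_ : (2 * j * 2 = 4 * j)%N); last by rewrite mulnAC.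
  rewrite exprS invfM !exprM -exprVn.
  have : (2 ^+ 2)^-1 ^+ j <= ((4 / 5) ^+ 4 : R) ^+ j.
    by apply: lerXn2r; rewrite ?nnegrE; lra.
  by apply: le_trans; apply: ler_piMl; [apply: exprn_ge0; lra|lra].
have c0 : 0 < 2 * alpha - 3 * gamma ^+ 2 by rewrite subr_gt0.
have mh : (2 ^ (2 * j).+1)%N%:R * h = T.
  by rewrite natrX /h /level_mesh; field; rewrite expf_neq0.
have mterm k : measurable_fun setT (fun w => (h / (S h k w ^+ 2 + e + 2 * alpha * h) ^+ 2)%:E).
  apply/measurable_EFinP; apply: measurable_funM => //.
  have eh0 : 0 < e + 2 * alpha * h by rewrite addr_gt0// !mulr_gt0.
  have -> : (fun w => (S h k w ^+ 2 + e + 2 * alpha * h) ^- 2) =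
      (fun w => ((S h k w ^+ 2 + (e + 2 * alpha * h))^-1) ^+ 2).
    by apply/funext => w; rewrite addrA exprVn.
  apply: measurable_funX.
  have mi := continuous_measurable_fun (inv_sqr_continuous eh0).
  exact: (measurableT_comp mi (measurable_fun_unif_scheme k (ltW h0))).
have EX (c : R) : expR (c * h) ^+ (2 ^ (2 * j).+1) = expR (c * T).
  by rewrite -expRM_natl mulrCA mh.
have := unif_scheme_sum_le (2 ^ (2 * j).+1) alpha0 beta0 (ltW ag) h0 e0 hT.
rewrite EX.
set A := (\int[P]_w _)%E; set B := (\sum_(_ <= _ < _) _)%E => H.
have A0 : (0 <= A)%E by apply: integral_ge0 => w _; rewrite lee_fin; nonneg.
have : (B <= (expR ((2 * beta + 300 * gamma ^+ 4 * T) * T) * (Y0 ^+ 2 + e)^-1)%:E)%E.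
  by apply: le_trans H; rewrite leeDr.
have -> : B = ((2 * alpha - 3 * gamma ^+ 2)%:E * \int[P]_w (level_sum alpha beta gamma Y0 T (fun s => W s w) j)%:E)%E.
  rewrite /level_sum -/h -/e.
  under [in RHS]eq_integral do rewrite -sumEFin.
  rewrite ge0_integral_sum//=; last by move=> k w _; rewrite lee_fin; nonneg.
  rewrite ge0_sume_distrr; last by move=> k _; apply: integral_ge0 => w _; rewrite lee_fin; nonneg.
  apply: eq_bigr => k _; rewrite -ge0_integralZl//.
  - by apply: eq_integral => w _; rewrite -EFinM -[in LHS]mulrA.
  - by move=> w _; rewrite lee_fin; nonneg.
  - by rewrite lee_fin ltW.
rewrite -lee_pdivlMl// => /le_trans; apply.
rewrite -EFinM lee_fin.
have Y20 : 0 < Y0 ^+ 2 by rewrite exprn_gt0.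
move: (expR_gt0 ((2 * beta + 300 * gamma ^+ 4 * T) * T)) c0.
set E := expR _; set c := 2 * alpha - _ => E0 c0; clearbody c.
have -> : c^-1 * (E * (Y0 ^+ 2 + e)^-1) = E / (c * (Y0 ^+ 2 + e)).
  by rewrite invfM; ring.
rewrite ler_pM2l// lef_pV2 ?posrE ?mulr_gt0 ?addr_gt0//.
by rewrite ler_pM2l// lerDl ltW.
Qed.

End wiener_scheme.

(** * Almost sure modulus of continuity *)

Section dominating_series.
Context (R : realType) d (Omega : measurableType d) (P : probability Omega R).

(** Used in place of the Borel-Cantelli lemma: the sum of the [X j] dominates each of them and,
    being integrable, is almost surely finite. It also supplies an integrable constant for the
    modulus of [W]. *)
Lemma dominating_series (X : nat -> Omega -> R) (C q : R) :
  (forall j, measurable_fun setT (X j)) -> (forall j w, 0 <= X j w) ->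
  0 <= C -> 0 <= q < 1 ->
  (forall j, (\int[P]_w (X j w)%:E <= (C * q ^+ j)%:E)%E) ->
  exists H : Omega -> \bar R, [/\ measurable_fun setT H,
    forall w, (0 <= H w)%E, (\int[P]_w H w <= (C / (1 - q))%:E)%E,
    {ae P, forall w, H w \is a fin_num} &
    forall j w, ((X j w)%:E <= H w)%E].
Proof.
move=> mX X0 C0 /andP[q0 q1] EX.
exists (fun w => \sum_(j <oo) (X j w)%:E)%E.
have mXE j : measurable_fun setT (fun w => (X j w)%:E) by exact/measurable_EFinP.
have X0E j w : (0 <= (X j w)%:E)%E by rewrite lee_fin.
have mH : measurable_fun setT (fun w => \sum_(j <oo) (X j w)%:E)%E.
  by apply: ge0_emeasurable_sum => //.
have H0 w : (0 <= \sum_(j <oo) (X j w)%:E)%E by apply: nneseries_ge0.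
have IH : (\int[P]_w (\sum_(j <oo) (X j w)%:E) <= (C / (1 - q))%:E)%E.
  rewrite integral_nneseries//.
  have I0 j : (0 <= \int[P]_w (X j w)%:E)%E by apply: integral_ge0 => w _; exact: X0E.
  apply: lime_le; first by apply: is_cvg_nneseries => j _ _; exact: I0.
  apply: nearW => n.
  apply: (@le_trans _ _ (\sum_(0 <= j < n) (C * q ^+ j)%:E)%E).
    exact: lee_sum.
  rewrite sumEFin lee_fin.
  have := @geometric_seriesE R C q; rewrite lt_eqF// => /(_ isT) /(congr1 (fun f => f n)).
  rewrite /series/= => ->.
  rewrite ler_pM2r ?invr_gt0 ?subr_gt0// ler_piMr// lerBlDr lerDl exprn_ge0//.
split => //.
- have : P.-integrable setT (fun w => \sum_(j <oo) (X j w)%:E)%E.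
    apply/integrableP; split => //.
    under eq_integral do rewrite gee0_abs//.
    by apply: le_lt_trans IH _; rewrite ltry.
  move=> /(integrable_ae measurableT); apply: filterS => w; exact.
- move=> j w.
  have := @nneseries_lim_ge R (fun j => (X j w)%:E) xpredT 0 j.+1 (fun k _ _ => X0E k w).
  apply: le_trans.
  by rewrite big_nat_recr//= leeDr// sume_ge0.
Qed.

End dominating_series.

Section wiener_modulus.
Context (R : realType) d (Omega : measurableType d) (P : probability Omega R).
Variables (W : R -> Omega -> R).
Hypothesis wW : wiener_process P W.

Lemma ge0_integral_wiener_increment (s t : R) (f : R -> R) :
  0 <= s -> s < t -> measurable_fun [set: R] f -> (forall x, 0 <= f x) ->
  (\int[P]_w (f (W t w - W s w))%:E =
   \int[normal_prob 0 (Num.sqrt (t - s))]_x (f x)%:E)%E.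
Proof.
move=> s0 st mf f0; have [mW _ _ nW _] := wW.
have mV : measurable_fun setT (fun w => W t w - W s w).
  by apply: measurable_funB; apply: mW => //; rewrite (le_trans s0)// ltW.
rewrite -[LHS](@ge0_integral_pushforward _ _ _ (measurableTypeR R) R _ mV P setT (fun x => (f x)%:E))//; last 2 first.
- exact/measurable_EFinP.
- by move=> x _; rewrite lee_fin.
apply: eq_measure_integral => A mA _.
exact: nW.
Qed.

Lemma wiener_modulus (T : R) : 0 < T -> exists H : Omega -> \bar R,
  [/\ measurable_fun setT H, forall w, (0 <= H w)%E,
    (\int[P]_w H w <= (1024 * T ^+ 3 / (1 - (5 / 4) ^+ 6 / 4))%:E)%E &
    {ae P, forall w, exists r, H w = r%:E /\
       dyadic_modulus T (9 * Num.sqrt (1 + r)) (fun s => W s w)}].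
Proof.
move=> T0; have [mW _ cW _ _] := wW.
pose g l : R := T / 2 ^+ l.
have g0 l : 0 < g l by rewrite /g divr_gt0// exprn_gt0.
pose D l i w := W (i.+1%:R * g l) w - W (i%:R * g l) w.
(* The [2 ^ l] increments have sixth moments at most [1024 * (T / 2 ^ l) ^ 3], where
   [1024 = 2 * 8 ^ 3]; the weighted sums therefore decay like [((5 / 4) ^ 6 / 4) ^ l]. *)
pose X l w := (5 / 4) ^+ (6 * l) * \sum_(0 <= i < 2 ^ l) D l i w ^+ 6.
have ig0 l i : 0 <= i%:R * g l by rewrite mulr_ge0// ltW.
have mD l i : measurable_fun setT (D l i).
  by apply: measurable_funB; apply: mW.
have mX l : measurable_fun setT (X l).
  apply: measurable_funM => //; apply: measurable_sum => i.
  exact: measurable_funX.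
have D0 l i w : 0 <= D l i w ^+ 6 by rewrite exprn_even_ge0.
have X0 l w : 0 <= X l w.
  by rewrite /X mulr_ge0 ?exprn_ge0 ?sumr_ge0//; lra.
have ED l i : (\int[P]_w (D l i w ^+ 6)%:E <= (1024 * g l ^+ 3)%:E)%E.
  have st : i%:R * g l < i.+1%:R * g l by rewrite ltr_pM2r// ltr_nat.
  rewrite (ge0_integral_wiener_increment (f := fun x => x ^+ 6) (ig0 l i) st); last 2 first.
  - exact: measurable_funX.
  - by move=> x; rewrite exprn_even_ge0.
  rewrite -mulrBl -natrB// subSnn mul1r.
  have sg0 : 0 < Num.sqrt (g l) by rewrite sqrtr_gt0.
  apply: le_trans (@normal_prob_even_moment R _ 3 sg0 isT) _.
  rewrite lee_fin exprM sqr_sqrtr ?(ltW (g0 l))//.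
  by rewrite le_eqVlt; apply/orP; left; apply/eqP; field.
have EX l : (\int[P]_w (X l w)%:E <= (1024 * T ^+ 3 * ((5 / 4) ^+ 6 / 4) ^+ l)%:E)%E.
  under eq_integral do rewrite EFinM -sumEFin.
  have mD6 i : measurable_fun setT (fun w => (D l i w ^+ 6)%:E).
    by apply/measurable_EFinP; exact: measurable_funX.
  have D6 i w : (0 <= (D l i w ^+ 6)%:E)%E by rewrite lee_fin.
  have c0 : (0 <= ((5 / 4) ^+ (6 * l) : R)%:E)%E by rewrite lee_fin exprn_ge0//; lra.
  have msum : measurable_fun setT (fun w => \sum_(0 <= i < 2 ^ l) (D l i w ^+ 6)%:E)%E.
    exact: emeasurable_sum.
  have sum0 w : (0 <= \sum_(0 <= i < 2 ^ l) (D l i w ^+ 6)%:E)%E by exact: sume_ge0.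
  rewrite ge0_integralZl//.
  rewrite ge0_integral_sum//.
  apply: (@le_trans _ _ (((5 / 4) ^+ (6 * l))%:E * \sum_(0 <= i < 2 ^ l) (1024 * g l ^+ 3)%:E)%E).
    apply: lee_wpmul2l; first by rewrite lee_fin exprn_ge0//; lra.
    by apply: lee_sum => i _; exact: ED.
  have sumc (c : R) : (\sum_(0 <= i < 2 ^ l) c%:E = (2 ^+ l * c)%:E)%E.
    by rewrite sumEFin sumr_const_nat subn0 -[c *+ _]mulr_natl natrX.
  rewrite sumc -EFinM lee_fin le_eqVlt; apply/orP; left; apply/eqP.
  have -> : ((5 / 4) ^+ 6 / 4 : R) ^+ l = (5 / 4) ^+ (6 * l) * (2 ^+ l) ^- 2.
    move: (5 / 4 : R) => a; rewrite exprMn -!exprM; congr (_ * _).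
    have -> : (4 : R) = 2 ^+ 2 by ring.
    by rewrite exprVn -exprM mulnC.
  rewrite /g; have : 2 ^+ l != 0 :> R by rewrite expf_neq0.
  move: (2 ^+ l) => B B0; move: (_ ^+ (6 * l)) => A.
  by field.
have q01 : 0 <= ((5 / 4) ^+ 6 / 4 : R) < 1.
  have -> : ((5 / 4) ^+ 6 / 4 : R) = (5 / 4) ^+ 6 * (1 / 4) by rewrite mul1r.
  have : 0 <= (5 / 4 : R) ^+ 6 < 4 by rewrite !exprS expr0; apply/andP; split; lra.
  by move=> /andP[a0 a4]; apply/andP; split; lra.
have C0 : 0 <= 1024 * T ^+ 3.
  by apply: mulr_ge0; [exact: ler0n|apply: exprn_ge0; exact: ltW].
have [H [mH H0 IH fH XH]] := dominating_series mX X0 C0 q01 EX.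
exists H; split => //.
apply: filterS fH => w Hfin.
exists (fine (H w)); split; first by rewrite fineK.
have r0 : 0 <= fine (H w) by rewrite fine_ge0.
set r := fine (H w) in r0 *.
apply: dyadic_chaining => //.
- exact: within_itvcy_itvcc.
- move=> l i il.
  have : X l w <= r by rewrite -lee_fin fineK.
  rewrite /X big_mkord (bigD1 (Ordinal il))//= => Xr.
  have c0 : 0 < (5 / 4 : R) ^+ (6 * l) by rewrite exprn_gt0//; lra.
  have {}Xr : (5 / 4) ^+ (6 * l) * D l i w ^+ 6 <= r.
    by apply: le_trans Xr; rewrite ler_pM2l// lerDl sumr_ge0.
  rewrite -/(g l) -/(D l i w).
  pose y := `|D l i w| * (5 / 4) ^+ l.
  have y0 : 0 <= y by rewrite mulr_ge0// exprn_ge0//; lra.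
  have y6 : y ^+ 6 <= r.
    rewrite /y exprMn -exprM mulnC mulrC (_ : `|D l i w| ^+ 6 = D l i w ^+ 6)//.
    by rewrite -normrX ger0_norm.
  (* A square root instead of a sixth root, so that the squared constant is affine in [r] and its
     mean is controlled by that of [H]. *)
  have y2 : y <= Num.sqrt (1 + r).
    rewrite -(ger0_norm y0) -sqrtr_sqr ler_wsqrtr//.
    have [y1|y1] := leP (y ^+ 2) 1; first by rewrite (le_trans y1)// lerDl.
    have : y ^+ 2 <= y ^+ 6.
      rewrite (_ : 6 = 2 * 3)%N// exprM ler_eXnr// ltW//.
    lra.
  have -> : `|D l i w| = y * (4 / 5) ^+ l.
    rewrite /y -mulrA -exprMn (_ : 5 / 4 * (4 / 5) = 1 :> R) ?expr1n ?mulr1//.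
    by field.
  by rewrite ler_wpM2r// exprn_ge0//; lra.
Qed.

End wiener_modulus.
(** * Positivity of the solution and the error bound *)

Section positivity.
Context (R : realType) d (Omega : measurableType d) (P : probability Omega R).
Variables (W Y : R -> Omega -> R) (alpha beta gamma Y0 T : R).
Hypothesis wW : wiener_process P W.

Lemma measurable_level_sum j : 0 < alpha -> 0 < T ->
  measurable_fun setT (fun w => level_sum alpha beta gamma Y0 T (fun s => W s w) j).
Proof.
move=> alpha0 T0; apply: measurable_sum => k; apply: measurable_funM => //.
set h := level_mesh T j.
have h0 : 0 < h by rewrite divr_gt0// exprn_gt0.
have e0 : 0 < (4 / 5) ^+ (2 * j) + 2 * alpha * h.
  by rewrite addr_gt0// ?mulr_gt0// exprn_gt0.
have cf : continuous (fun y : R => (y ^+ 2 + ((4 / 5) ^+ (2 * j) + 2 * alpha * h)) ^- 2).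
  move=> y; apply: cvgV.
    by rewrite gt_eqF// exprn_gt0// ltr_wpDl ?sqr_ge0.
  apply: (cvg_comp _ (fun x : R => x ^+ 2)); last exact: sqr_continuous.
  by apply: cvgD; [exact: sqr_continuous|exact: cvg_cst].
have mS := measurable_fun_unif_scheme wW alpha beta gamma Y0 k (ltW h0).
have := measurableT_comp (continuous_measurable_fun cf) mS.
by congr (measurable_fun _ _); apply/funext => w /=; rewrite addrA.
Qed.

Lemma ge1Dn_exprn (x : R) n : 0 <= x -> 1 + x * n%:R <= (1 + x) ^+ n.
Proof.
move=> x0; elim: n => [|n IH]; first by rewrite mulr0 addr0 expr0.
rewrite exprS; have := ler_wpM2l (addr_ge0 ler01 x0) IH; apply: le_trans.
have : 0 <= x * x * n%:R by rewrite !mulr_ge0.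
by rewrite -natr1; lra.
Qed.

Lemma sde_solution_gt0 :
  sde_solution P W alpha beta gamma Y0 T Y ->
  0 < alpha -> 0 < beta -> 0 <= gamma -> 3 * gamma ^+ 2 < 2 * alpha ->
  0 < T -> 0 < Y0 ->
  {ae P, forall w, forall t, 0 <= t <= T -> 0 < Y t w}.
Proof.
move=> [_ _ cY intY eqY] alpha0 beta0 gamma0 ag T0 Y00.
have [_ _ cW _ _] := wW.
(* The weight [9 / 10] makes the expectations summable and still leaves growth on a path that hits
   zero: [625 / 512 * (9 / 10) >= 1 + 9 / 100]. *)
pose X j w := level_sum alpha beta gamma Y0 T (fun s => W s w) j * (9 / 10) ^+ j.
pose C := expR ((2 * beta + 300 * gamma ^+ 4 * T) * T)
     / ((2 * alpha - 3 * gamma ^+ 2) * Y0 ^+ 2).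
have q0 j : 0 <= (9 / 10 : R) ^+ j by apply: exprn_ge0; lra.
have mX j : measurable_fun setT (X j).
  by apply: measurable_funM => //; exact: measurable_level_sum.
have L0 j w : 0 <= level_sum alpha beta gamma Y0 T (fun s => W s w) j.
  apply: sumr_ge0 => k _; apply: mulr_ge0; last by rewrite invr_ge0 sqr_ge0.
  by rewrite ltW// divr_gt0// exprn_gt0.
have X0 j w : 0 <= X j w by rewrite mulr_ge0.
have C0 : 0 <= C.
  rewrite /C divr_ge0 ?expR_ge0// mulr_ge0 ?sqr_ge0//.
  by rewrite subr_ge0 ltW.
have q01 : 0 <= (9 / 10 : R) < 1 by apply/andP; split; lra.
have EX j : (\int[P]_w (X j w)%:E <= (C * (9 / 10) ^+ j)%:E)%E.
  under eq_integral do rewrite EFinM.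
  have mL : measurable_fun setT
      (fun w => (level_sum alpha beta gamma Y0 T (fun s => W s w) j)%:E).
    by apply/measurable_EFinP; exact: measurable_level_sum.
  have qE : (0 <= ((9 / 10 : R) ^+ j)%:E)%E by rewrite lee_fin.
  rewrite ge0_integralZr//; last by move=> w _; rewrite lee_fin.
  rewrite EFinM; apply: lee_wpmul2r; first by rewrite lee_fin.
  exact: expectation_level_sum_le.
have [H [_ _ _ fH XH]] := dominating_series mX X0 C0 q01 EX.
have [G [_ G0 _ modW]] := wiener_modulus wW T0.
apply: filterS3 (filterI fH modW) intY eqY => w [Hw [r [Gr mod]]] intw eqw t tT.
rewrite ltNge; apply/negP => Yt.
have [||||||||||||c c0 [j0 Hc]] := @level_sum_hit R alpha beta gamma Y0 T (9 * Num.sqrt (1 + r)) (fun s => Y s w) (fun s => W s w).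
- done.
- done.
- done.
- done.
- done.
- by rewrite mulr_ge0// sqrtr_ge0.
- exact: cY.
- exact: within_itvcy_itvcc.
- exact: intw.
- exact: eqw.
- exact: mod.
- by exists t.
pose M := fine (H w).
have XM j : X j w <= M by rewrite -lee_fin fineK.
have bound j : (j0 <= j)%N -> c * (1 + 9 / 100 * j%:R) <= M.
  move=> jj; apply: le_trans (XM j).
  rewrite /X; have := ler_wpM2r (q0 j) (Hc j jj); apply: le_trans.
  have -> : c * (625 / 512) ^+ j * (9 / 10) ^+ j = c * (625 / 512 * (9 / 10)) ^+ j.
    by rewrite [in RHS]exprMn mulrA.
  rewrite ler_pM2l//.
  apply: le_trans (ge1Dn_exprn _ _) _; first by lra.
  by apply: lerXn2r; rewrite ?nnegrE; lra.
pose j1 := (j0 + (Num.truncn (M / c * (100 / 9))).+1)%N.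
have := bound j1 (leq_addr _ _).
rewrite leNgt => /negP; apply.
rewrite mulrC -ltr_pdivrMr// -ltrBlDl.
have : M / c * (100 / 9) < j1%:R.
  apply: lt_le_trans (truncnS_gt _) _.
  by rewrite ler_nat leq_addl.
lra.
Qed.

End positivity.

(** * From the pathwise error to the expectation *)

Section nonmeasurable_comparison.
Context (R : realType) d (Omega : measurableType d) (P : probability Omega R).
Import HBNNSimple.

(* The integral of a nonnegative function is a supremum over the simple functions
   below it, so the smaller function need not be measurable. *)
Lemma ae_ge0_le_integral_nonmeasurable (f g : Omega -> \bar R) :
  (forall w, 0 <= f w)%E -> (forall w, 0 <= g w)%E -> measurable_fun setT g ->
  {ae P, forall w, (f w <= g w)%E} ->
  (\int[P]_w f w <= \int[P]_w g w)%E.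
Proof.
move=> f0 g0 mg fg; rewrite ge0_integralTE//; apply: ge_ereal_sup => _ [h hf <-].
rewrite -integralT_nnsfun; apply: ae_ge0_le_integral => //.
- by move=> w _; rewrite lee_fin.
- exact/measurable_EFinP.
- by apply: filterS fg => w fgw _; exact: le_trans (hf w) fgw.
Qed.
End nonmeasurable_comparison.

Section path_error.
Context (R : realType).
Variables (alpha beta gamma Y0 : R).

(** The least [j] with [T / 2 ^ (j + 1) < delta] works. The rate follows from
    [(4 / 5) ^ 4 <= 1 / 2], and the bound [x <= T] covers [delta > T], where [j = 0]. *)
Lemma dyadic_level (T delta : R) : 0 < T -> 0 < delta ->
  exists2 j, forall x, x <= T -> x <= delta -> x <= T / 2 ^+ j &
    ((4 / 5) ^+ (2 * j) : R) <= Num.sqrt (2 / T) * Num.sqrt delta.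
Proof.
move=> T0 d0.
have ex : exists j, T / 2 ^+ j.+1 < delta.
  exists (Num.truncn (T / delta)).+1.
  rewrite ltr_pdivrMr ?exprn_gt0// mulrC -ltr_pdivrMr//.
  apply: lt_le_trans (truncnS_gt _) _.
  rewrite -natrX ler_nat ltnW//.
  apply: (@leq_trans (2 ^ (Num.truncn (T / delta)).+1)); first exact: ltn_expl.
  by rewrite leq_exp2l.
have [j Hj minj] := ex_minnP ex.
exists j.
  move=> x xT xd; case: j Hj minj => [_ _|i _ minj]; first by rewrite expr0 divr1.
  apply: le_trans xd _; rewrite leNgt; apply/negP => H.
  by have := minj i H; rewrite ltnn.
have T20 : 0 <= 2 / T by rewrite divr_ge0// ltW.
rewrite -sqrtrM//.
have a0 : 0 <= (4 / 5 : R) ^+ (2 * j) by apply: exprn_ge0; lra.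
rewrite -(ger0_norm a0) -sqrtr_sqr; apply: ler_wsqrtr.
have H1 : ((4 / 5 : R) ^+ (2 * j)) ^+ 2 <= (2 ^+ j)^-1.
  rewrite -exprM (_ : (2 * j * 2 = 4 * j)%N); last by rewrite mulnAC.
  rewrite exprM -exprVn; apply: lerXn2r; rewrite ?nnegrE ?exprn_ge0 ?invr_ge0//; lra.
apply: le_trans H1 _.
rewrite exprS in Hj; have p0 : 0 < 2 ^+ j :> R by rewrite exprn_gt0.
rewrite mulrAC ler_pdivlMr// mulrC.
have : T / (2 * 2 ^+ j) = (T / 2 ^+ j) / 2 by field; rewrite gt_eqF.
move=> E; rewrite E in Hj; lra.
Qed.

(** The integral equals the square root minus [|S n|], so the continuous version is off by a
    discounted [|S n| - S n] when [S n < 0]. As [Y (t n) > 0], this is at most twice the error at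
    [t n]; hence the factor [3 = 1 + 2]. *)
Lemma scheme_path_error (delta eta K T s : R) (n : nat) (t S : nat -> R) (Y w : R -> R) :
  0 < alpha -> 0 < beta -> 0 <= delta -> 0 <= eta ->
  4 * alpha * beta * delta ^+ 2 <= eta ^+ 2 ->
  t 0%N = 0 -> t n <= s <= T -> s - t n <= delta ->
  (forall k, (k < n)%N -> 0 <= t k.+1 - t k <= delta) ->
  (forall k, S k.+1 = expR (- beta * (t k.+1 - t k)) *
     (Num.sqrt (S k ^+ 2 + 2 * alpha * (t k.+1 - t k))
      + gamma * (w (t k.+1) - w (t k)))) ->
  S 0%N = Y 0 ->
  (forall u, 0 <= u <= T -> 0 < Y u) ->
  {within `[0, T], continuous Y} -> {within `[0, T], continuous w} ->
  (forall u, 0 < u < T ->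
     is_derive u 1 (fun v => Y v - gamma * w v)
       (alpha * (Y u)^-1 - beta * Y u)) ->
  (forall s u, 0 <= s <= T -> 0 <= u <= T -> `|s - u| <= delta ->
     `|gamma * (w s - w u)| <= K) ->
  `|Y s - (expR (- beta * (s - t n)) *
      (S n + \int[lebesgue_measure]_(u in `[t n, s])
         (alpha / Num.sqrt (S n ^+ 2 + 2 * alpha * (u - t n))))
    + expR (- beta * (s - t n)) * gamma * (w s - w (t n)))|
  <= 3 * (K + eta + beta * K * T).
Proof.
move=> alpha0 beta0 delta0 eta0 le_eta t0 /andP[ts sT] sd dt SS S0 Ypos cY cw dY wK.
have tnT : t n <= T := le_trans ts sT.
have [D1 /(_ s) D2] := scheme_error alpha0 beta0 delta0 eta0 le_eta t0 tnT dt SS S0 Ypos cY cw dY wK.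
have {}D2 := D2 _ sd; rewrite ts sT in D2; have {}D2 := D2 isT.
have tn0 : 0 <= t n.
  elim: n {ts sd tnT D1 D2} dt => [|n IH] dt; first by rewrite t0.
  have /andP[+ _] := dt n (ltnSn n); rewrite subr_ge0; apply: le_trans.
  by apply: IH => k kn; apply: dt; exact: ltnW.
have T0 : 0 <= T := le_trans tn0 tnT.
have K0 : 0 <= K.
  by apply: le_trans (wK 0 0 _ _ _) => //; rewrite ?lexx// subrr normr0.
have bK : 0 <= beta * K by rewrite mulr_ge0// ltW.
have B1 : K + eta + beta * K * t n <= K + eta + beta * K * T.
  by rewrite lerD2l ler_wpM2l.
have B2 : K + eta + beta * K * s <= K + eta + beta * K * T.
  by rewrite lerD2l ler_wpM2l.
have Ytn : 0 < Y (t n) by apply: Ypos; rewrite tn0.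
rewrite integral_inv_sqrt//.
set E := expR _ in D2 *; set Z := Num.sqrt _ in D2 *.
have E0 : 0 <= E by exact: expR_ge0.
have E1 : E <= 1.
  by rewrite -[leRHS]expR0 ler_expR mulNr oppr_le0 mulr_ge0 ?subr_ge0// ltW.
have -> : Y s - (E * (S n + (Z - `|S n|)) + E * gamma * (w s - w (t n))) =
  - (E * (Z + gamma * (w s - w (t n))) - Y s) + E * (`|S n| - S n) by ring.
rewrite (le_trans (ler_normD _ _))// normrN.
have -> : 3 * (K + eta + beta * K * T) = (K + eta + beta * K * T) +
   2 * (K + eta + beta * K * T) by ring.
apply: lerD; first exact: le_trans D2 B2.
have sn0 : 0 <= `|S n| - S n by rewrite subr_ge0 ler_norm.
rewrite ger0_norm ?mulr_ge0//.
apply: (@le_trans _ _ (`|S n| - S n)); first by rewrite ler_piMl.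
have D3 := le_trans D1 B1.
rewrite ler_norml in D3; case/andP: D3 => D3 D4.
have [Sn|Sn] := leP 0 (S n); first by rewrite ger0_norm// subrr; lra.
by rewrite ltr0_norm//; lra.
Qed.
End path_error.
Lemma mesh_index_spec (R : realType) d (Omega : measurableType d)
    (t : nat -> Omega -> R) (N : Omega -> nat) (T delta s : R) (w : Omega) :
  t 0%N w = 0 -> (forall n, (n < N w)%N -> t n.+1 w - t n w <= delta) ->
  t (N w) w = T -> 0 <= delta -> 0 <= s <= T ->
  [/\ (mesh_index t N s w <= N w)%N, t (mesh_index t N s w) w <= s
    & s - t (mesh_index t N s w) w <= delta].
Proof.
move=> t0 dt tN delta0 /andP[s0 sT].
pose p (i : 'I_(N w).+1) := t i w <= s.
have p0 : p ord0 by rewrite /p /= t0.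
have [i pi E] := @eq_bigmax_cond _ p (fun i => nat_of_ord i) (introT card_gt0P (ex_intro _ ord0 p0)).
have mE : mesh_index t N s w = i by rewrite /mesh_index -E.
rewrite mE; split => //; first by rewrite -ltnS.
have := ltn_ord i; rewrite ltnS leq_eqVlt => /predU1P[iN|iN].
  by rewrite iN tN; lra.
have : s < t i.+1 w.
  rewrite ltNge; apply/negP => si.
  have iN' : (i.+1 < (N w).+1)%N by [].
  have : (Ordinal iN' <= mesh_index t N s w)%N by exact: (@leq_bigmax_cond _ p (fun i => nat_of_ord i)).
  by rewrite mE ltnn.
have := dt i iN; lra.
Qed.

Lemma ae_ex (R : realType) d (Omega : measurableType d) (P : probability Omega R)
    (Q : Omega -> Prop) : {ae P, forall w, Q w} -> exists w, Q w.
Proof.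
move=> [A [mA PA QA]]; apply: contrapT => nQ.
have AT : A = setT.
  apply/seteqP; split => // w _; apply: QA => /= Qw; apply: nQ; by exists w.
move: PA; rewrite AT probability_setT => /eqP.
by rewrite onee_eq0.
Qed.

Theorem theorem13 (R : realType) (kappa theta sigma T Y0 : R)
    (kappa_gt0 : 0 < kappa) (theta_gt0 : 0 < theta) (sigma_gt0 : 0 < sigma)
    (hparam : sigma ^+ 2 < kappa * theta) (T_gt0 : 0 < T) (Y0_gt0 : 0 < Y0) :
  let alpha := (4 * kappa * theta - sigma ^+ 2) / 8 in
  let beta := kappa / 2 in
  let gamma := sigma / 2 in
  exists C3 : R,
  forall (d : measure_display) (Omega : measurableType d)
    (P : probability Omega R) (W Y : R -> Omega -> R),
  wiener_process P W ->
  sde_solution P W alpha beta gamma Y0 T Y ->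
  forall (t : nat -> Omega -> R) (N : Omega -> nat) (Nmax : nat) (dtmax : R),
  random_mesh (natural_filtration W) T t N ->
  {ae P, forall w, (N w <= Nmax)%N} ->
  {ae P, forall w, forall n, (n < N w)%N -> t n.+1 w - t n w <= dtmax} ->
  dtmax <= Num.min 1 kappa^-1 ->
  let Ybar := continuous_version alpha beta gamma Y0 W t N in
  let E_Y (s : R) (w : Omega) := Y s w - Ybar s w in
  (forall s : R, 0 <= s <= T ->
     ('E_P[fun w => (E_Y s w ^+ 2)%R] <= (C3 * Num.sqrt dtmax)%:E)%E) /\
  (forall n : nat, (n <= Nmax)%N ->
     ('E_P[fun w => (E_Y (t n w) w ^+ 2 * \1_[set w' | (n <= N w')%N] w)%R]
        <= (C3 * Num.sqrt dtmax)%:E)%E).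
Proof.
move=> alpha beta gamma.
have kt : 0 < kappa * theta by rewrite mulr_gt0.
have sigma2 : 0 <= sigma ^+ 2 by exact: sqr_ge0.
have alpha0 : 0 < alpha by rewrite /alpha divr_gt0//; lra.
have beta0 : 0 < beta by rewrite /beta divr_gt0.
have gamma0 : 0 < gamma by rewrite /gamma divr_gt0.
(* In fact [2 * alpha - 3 * gamma ^ 2 = kappa * theta - sigma ^ 2]. *)
have ag : 3 * gamma ^+ 2 < 2 * alpha.
  have -> : gamma ^+ 2 = sigma ^+ 2 / 4 by rewrite /gamma; field.
  by rewrite /alpha; lra.
clearbody alpha beta gamma.
(* Here [9] is the square of the factor 3 of [scheme_path_error], [162 = 2 * 9 ^ 2] comes from
   [K ^ 2] and [8 = 2 * 2 ^ 2] from [eta ^ 2], the 2 being that of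
   [(x + y) ^ 2 <= 2 * x ^ 2 + 2 * y ^ 2]. [CH] bounds the mean of [H] in [wiener_modulus]. *)
pose D := 9 * (162 * (1 + beta * T) ^+ 2 * gamma ^+ 2 * Num.sqrt (2 / T)
  + 8 * (alpha + beta) ^+ 2).
pose CH := 1024 * T ^+ 3 / (1 - (5 / 4) ^+ 6 / 4).
exists (D * (1 + CH)).
move=> d Omega P W Y wW sY t N Nmax dtmax [_ _ _ mesh] _ dt_le dt_min Ybar E_Y.
have dt1 : dtmax <= 1 by move: dt_min; rewrite le_min => /andP[].
(* Positivity of [dtmax] is read off a single sample point: its mesh has at least one step because
   [T > 0]. *)
have dtmax0 : 0 < dtmax.
  have [w Hw] := ae_ex dt_le; have [t0 tlt tN] := mesh w.
  have N0 : (0 < N w)%N.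
    by rewrite lt0n; apply/eqP => N0; move: tN; rewrite N0 t0 => E; move: T_gt0; rewrite -E ltxx.
  have := Hw 0%N N0; have := tlt 0%N N0; lra.
have D0 : 0 <= D by rewrite /D; nonneg.
have [_ _ cY intY eqY] := sY.
have [_ _ cW _ _] := wW.
have posY := sde_solution_gt0 wW sY alpha0 beta0 (ltW gamma0) ag T_gt0 Y0_gt0.
have [H [mH H0 IH modW]] := wiener_modulus wW T_gt0.
have [j jdt aj] := dyadic_level T_gt0 dtmax0.
(* The null set is independent of [s], so the bound may be evaluated at the random times [t n w]. *)
have bound : {ae P, forall w, forall s, 0 <= s <= T ->
    ((E_Y s w ^+ 2)%:E <= (D * Num.sqrt dtmax)%:E * (1 + H w))%E}.
  apply: filterS3 (filterI posY modW) (filterI intY eqY) dt_le.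
  move=> w [Ypos [r [Hr mod]]] [intw eqw] dtw s sT.
  have r0 : 0 <= r by rewrite -lee_fin -Hr.
  have [t0 tlt tN] := mesh w.
  have [nN tns sd] := mesh_index_spec t0 dtw tN (ltW dtmax0) sT.
  set n := mesh_index t N s w in nN tns sd.
  pose eta := 2 * (alpha + beta) * dtmax.
  pose K := gamma * (9 * Num.sqrt (1 + r) * (4 / 5) ^+ j).
  have YY0 : Y 0 w = Y0.
    by rewrite eqw ?lexx ?ltW// set_itv1 Rintegral_set1 subrr mulr0 !addr0.
  have eta0 : 0 <= eta by rewrite /eta; nonneg.
  have le_eta : 4 * alpha * beta * dtmax ^+ 2 <= eta ^+ 2.
    rewrite /eta [leRHS]exprMn ler_wpM2r ?sqr_ge0//.
    have : 0 <= (alpha - beta) ^+ 2 by exact: sqr_ge0.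
    have := mulr_gt0 alpha0 beta0.
    lra.
  have dYw u : 0 < u < T -> is_derive u 1 (fun v => Y v w - gamma * W v w)
       (alpha * (Y u w)^-1 - beta * Y u w).
    move=> /andP[u0 uT].
    apply: (is_derive_sde_path (cY w) intw eqw (lexx T)); first by rewrite u0.
    by apply: Ypos; rewrite !ltW.
  have wK u v : 0 <= u <= T -> 0 <= v <= T -> `|u - v| <= dtmax ->
      `|gamma * (W u w - W v w)| <= K.
    move=> uT vT uv; rewrite normrM (gtr0_norm gamma0) ler_pM2l//.
    apply: mod => //; apply: jdt => //.
    move: uT vT => /andP[u0 u1] /andP[v0 v1]; clear -u0 u1 v0 v1.
    by rewrite ler_norml; apply/andP; split; lra.
  have sn : t n w <= s <= T by rewrite tns; case/andP: sT.
  have dtn k : (k < n)%N -> 0 <= t k.+1 w - t k w <= dtmax.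
    move=> kn; have kN := leq_trans kn nN.
    by rewrite dtw// andbT subr_ge0 ltW// tlt.
  have EB : `|E_Y s w| <= 3 * (K + eta + beta * K * T).
    exact: (@scheme_path_error _ alpha beta gamma dtmax eta K T s n (fun k => t k w)
      (fun k => scheme alpha beta gamma Y0 W t k w) (fun v => Y v w) (fun v => W v w)
      alpha0 beta0 (ltW dtmax0) eta0 le_eta t0 sn sd dtn (fun=> erefl) (esym YY0)
      Ypos (cY w) (within_itvcy_itvcc (cW w)) dYw wK).
  rewrite Hr -EFinD -EFinM lee_fin.
  have sd0 : 0 <= Num.sqrt dtmax by exact: sqrtr_ge0.
  have K2 : K ^+ 2 <= 81 * gamma ^+ 2 * Num.sqrt (2 / T) * Num.sqrt dtmax * (1 + r).
    have -> : K ^+ 2 = 81 * gamma ^+ 2 * (1 + r) * (4 / 5) ^+ (2 * j).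
      rewrite /K (mulnC 2) exprM -[in RHS](@sqr_sqrtr _ (1 + r)) ?addr_ge0//; ring.
    have c0 : 0 <= 81 * gamma ^+ 2 * (1 + r) by nonneg.
    have := ler_wpM2l c0 aj; lra.
  have eta2 : eta ^+ 2 <= 4 * (alpha + beta) ^+ 2 * Num.sqrt dtmax * (1 + r).
    have d2 : dtmax ^+ 2 <= Num.sqrt dtmax.
      have s1 : Num.sqrt dtmax <= 1 by rewrite -sqrtr1 ler_wsqrtr.
      rewrite -{1}(sqr_sqrtr (ltW dtmax0)) -exprM.
      by rewrite -[leRHS]expr1; apply: ler_wiXn2l.
    have d3 : Num.sqrt dtmax <= Num.sqrt dtmax * (1 + r) by rewrite ler_peMr// lerDl.
    have c0 : 0 <= 4 * (alpha + beta) ^+ 2 by nonneg.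
    have := ler_wpM2l c0 (le_trans d2 d3).
    by rewrite /eta; lra.
  have E2 : E_Y s w ^+ 2 <= (3 * (K + eta + beta * K * T)) ^+ 2.
    rewrite -(real_normK (num_real (E_Y s w))); apply: lerXn2r; rewrite ?nnegrE//.
    exact: le_trans EB.
  apply: le_trans E2 _.
  have E3 : (3 * (K + eta + beta * K * T)) ^+ 2 <=
      9 * (2 * (1 + beta * T) ^+ 2 * K ^+ 2 + 2 * eta ^+ 2).
    rewrite -subr_ge0.
    have -> : 9 * (2 * (1 + beta * T) ^+ 2 * K ^+ 2 + 2 * eta ^+ 2)
       - (3 * (K + eta + beta * K * T)) ^+ 2 = 9 * ((1 + beta * T) * K - eta) ^+ 2 by ring.
    by nonneg.
  apply: le_trans E3 _.
  have c1 : 0 <= (1 + beta * T) ^+ 2 by exact: sqr_ge0.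
  have := ler_wpM2l c1 K2.
  rewrite /D; lra.
have mG : measurable_fun setT (fun w => (D * Num.sqrt dtmax)%:E * (1 + H w))%E.
  by apply: emeasurable_funM => //; apply: emeasurable_funD.
have Ds0 : 0 <= D * Num.sqrt dtmax by rewrite mulr_ge0// sqrtr_ge0.
have G0 w : (0 <= (D * Num.sqrt dtmax)%:E * (1 + H w))%E.
  by rewrite mule_ge0 ?lee_fin// adde_ge0.
have IG : (\int[P]_w ((D * Num.sqrt dtmax)%:E * (1 + H w)) <=
    (D * (1 + CH) * Num.sqrt dtmax)%:E)%E.
  rewrite ge0_integralZl//; last 2 first.
  - exact: emeasurable_funD.
  - by move=> w _; rewrite adde_ge0.
  rewrite ge0_integralD//= integral_cst//= probability_setT mul1e.
  rewrite (_ : D * (1 + CH) * Num.sqrt dtmax = D * Num.sqrt dtmax * (1 + CH)); last by ring.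
  rewrite [leRHS]EFinM; apply: lee_wpmul2l; first by rewrite lee_fin.
  by rewrite EFinD leeD.
split=> [s sT|n _]; rewrite unlock; apply: le_trans IG;
  apply: ae_ge0_le_integral_nonmeasurable => //.
- by move=> w; rewrite lee_fin sqr_ge0.
- by apply: filterS bound => w; apply.
- by move=> w; rewrite lee_fin mulr_ge0 ?sqr_ge0.
apply: filterS bound => w bw.
rewrite indicE; case: (boolP (w \in _)) => [|_]; last by rewrite mulr0.
rewrite inE /= mulr1 => nN; apply: bw.
have [t0 tlt tN] := mesh w.
have mono k m : (k <= m)%N -> (m <= N w)%N -> t k w <= t m w.
  elim: m => [|m IHm]; first by rewrite leqn0 => /eqP ->.
  rewrite leq_eqVlt => /predU1P[->//|]; rewrite ltnS => km mN.
  by rewrite (le_trans (IHm km (ltnW mN)))// ltW// tlt.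
by rewrite -t0 -tN !mono.
Qed.
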